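(* Let $X$ be a complex Hilbert space with open unit ball $B$, let $0\le\alpha<1$, and define $$A(\alpha)=\begin{cases}\dfrac{(2-\alpha)\sqrt{1-2\alpha}}{\sqrt{5-2\alpha}}, & 0\le\alpha\le\frac14,\\[2mm] \dfrac{(2-\alpha)(1-\alpha)}{2+\alpha}, & \frac14<\alpha\le\frac25,\\[2mm] \alpha, & \frac25<\alpha<\frac12,\\[1mm] 1-\alpha, & \frac12\le\alpha<1.\end{cases}$$ Let $SK(B,\alpha)$ be the set of all holomorphic mappings $f:B\to X$ of the form $f(z)=z+\sum_{k=2}^\infty A_k(z^k)$ such that $\sum_{k=2}^\infty k(k-\alpha)\|A_k\|\le A(\alpha)$, and let $SS^{*}(B,\alpha)$ be the set of all holomorphic mappings $f:B\to X$ of the form $f(z)=z+\sum_{k=2}^\infty A_k(z^k)$ such that $\sum_{k=2}^\infty (k-\alpha)\|A_k\|\le A(\alpha)$. Then $SK(B,\alpha)\subset K(B)$, $SS^{*}(B,\alpha)\subset S^{*}(B)$, and, for every holomorphic mapping $f:B\to X$ of the form $f(z)=z+\sum_{k=2}^\infty A_k(z^k)$, one has $f\in SK(B,\alpha)$ if and only if the mapping $z\mapsto Df(z)(z)$ belongs to $SS^{*}(B,\alpha)$.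
   Context: $X$ is a complex Hilbert space with inner product $\langle\cdot,\cdot\rangle$ and norm $\|\cdot\|$, and $B=\{z\in X:\|z\|<1\}$. $Df(z)$ and $D^kf(z)$ denote the first and $k$-th Fréchet derivatives of a holomorphic mapping $f$ at $z$. In the expansion of $f$, $A_k=\frac1{k!}D^kf(0)$ is a bounded symmetric $k$-linear operator $X\times\cdots\times X\to X$, $A_k(z^k)=A_k(z,\dots,z)$, and $\|A_k\|$ is its norm as a bounded $k$-linear operator. $I$ is the identity operator on $X$. A mapping $f:B\to X$ is biholomorphic if it is holomorphic, $f(B)$ is a domain, and the inverse $f^{-1}$ exists and is holomorphic on $f(B)$. $K(B)$ is the class of biholomorphic mappings $f:B\to X$ with $f(0)=0$, $Df(0)=I$ that are convex, i.e. $(1-t)f(z_1)+tf(z_2)\in f(B)$ for all $z_1,z_2\in B$ and $0\le t\le1$. $S^{*}(B)$ is the class of biholomorphic mappings $f:B\to X$ with $f(0)=0$, $Df(0)=I$ that are starlike, i.e. $tf(B)\subset f(B)$ for $0\le t\le1$. *)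

(* Defs.v *)
From Stdlib Require Import Reals Lra Arith.Factorial ClassicalEpsilon FunctionalExtensionality
  ProofIrrelevance.
From Coquelicot Require Import Coquelicot.

Open Scope R_scope.

(** The completeness and the topology are those of the norm, which
    [inner_norm] ties to the inner product (linear in the first variable). *)
Record HilbertSpace := {
  hilbert_carrier :> CompleteNormedModule C_AbsRing;
  inner : hilbert_carrier -> hilbert_carrier -> C;
  inner_plus : forall x y z, inner (plus x y) z = Cplus (inner x z) (inner y z);
  inner_scal : forall (c : C) x y, inner (scal c x) y = Cmult c (inner x y);
  inner_conj : forall x y, inner y x = Cconj (inner x y);
  inner_norm : forall x, inner x x = RtoC (norm x ^ 2)
}.

Section BoundedLinear.

Context (U V : NormedModule C_AbsRing).

Record Lin := mkLin {
  lin_fun :> U -> V;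
  lin_linear : is_linear lin_fun
}.

Lemma Lin_ext (l m : Lin) : (forall x, l x = m x) -> l = m.
Proof.
destruct l as [l Hl], m as [m Hm]; simpl; intros H.
assert (E : l = m) by (apply functional_extensionality; exact H).
subst m; f_equal; apply proof_irrelevance.
Qed.

Lemma is_linear_add (l m : U -> V) :
  is_linear l -> is_linear m -> is_linear (fun x => plus (l x) (m x)).
Proof.
intros Hl Hm.
exact (is_linear_comp _ _ (is_linear_prod l m Hl Hm) is_linear_plus).
Qed.

Lemma is_linear_neg (l : U -> V) : is_linear l -> is_linear (fun x => opp (l x)).
Proof. intros Hl; exact (is_linear_comp _ _ Hl is_linear_opp). Qed.

Lemma is_linear_scale (c : C) (l : U -> V) :
  is_linear l -> is_linear (fun x => scal (c : C_AbsRing) (l x)).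
Proof.
intros Hl; apply (is_linear_comp _ _ Hl), is_linear_scal_r.
intros n m; apply Cmult_comm.
Qed.

Definition Lin_zero : Lin := mkLin (fun _ => zero) is_linear_zero.
Definition Lin_plus (l m : Lin) : Lin :=
  mkLin _ (is_linear_add l m (lin_linear l) (lin_linear m)).
Definition Lin_opp (l : Lin) : Lin := mkLin _ (is_linear_neg l (lin_linear l)).
Definition Lin_scal (c : C_AbsRing) (l : Lin) : Lin :=
  mkLin _ (is_linear_scale c l (lin_linear l)).

Definition opnorm (l : Lin) : R :=
  real (Lub_Rbar (fun r => exists x : U, norm x <= 1 /\ r = norm (l x))).

Lemma opnorm_lub (l : Lin) :
  is_lub_Rbar (fun r => exists x : U, norm x <= 1 /\ r = norm (l x)) (opnorm l).
Proof.
unfold opnorm.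
set (E := fun r => exists x : U, norm x <= 1 /\ r = norm (l x)).
assert (HL := Lub_Rbar_correct E).
destruct (linear_norm _ (lin_linear l)) as [M [HM Hb]].
assert (Hup : is_ub_Rbar E M).
{ intros r [x [Hx ->]]; simpl.
  apply Rle_trans with (1 := Hb x).
  rewrite <- (Rmult_1_r M) at 2.
  apply Rmult_le_compat_l; [lra | exact Hx]. }
assert (H0 : E (norm (l zero))).
{ exists zero; split; [rewrite norm_zero; lra | reflexivity]. }
destruct HL as [HL1 HL2].
assert (B1 := HL2 M Hup).
assert (B2 := HL1 _ H0).
destruct (Lub_Rbar E) as [r | |]; simpl in *; try contradiction.
split; assumption.
Qed.

Lemma opnorm_unit (l : Lin) (x : U) : norm x <= 1 -> norm (l x) <= opnorm l.
Proof. intros Hx; apply (proj1 (opnorm_lub l)); exists x; auto. Qed.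

Lemma opnorm_least (l : Lin) (M : R) :
  (forall x, norm x <= 1 -> norm (l x) <= M) -> opnorm l <= M.
Proof.
intros H; apply (proj2 (opnorm_lub l) (Finite M)).
intros r [x [Hx ->]]; exact (H x Hx).
Qed.

Lemma opnorm_ge0 (l : Lin) : 0 <= opnorm l.
Proof.
apply Rle_trans with (norm (l zero)); [apply norm_ge_0 | apply opnorm_unit].
rewrite norm_zero; lra.
Qed.

Lemma opnorm_bound (l : Lin) (x : U) : norm (l x) <= opnorm l * norm x.
Proof.
destruct (Req_dec (norm x) 0) as [H0 | H0].
{ apply norm_eq_zero in H0; subst x.
  rewrite (linear_zero l (lin_linear l)), !norm_zero; lra. }
assert (Hx : 0 < norm x) by (assert (h := norm_ge_0 x); lra).
set (c := RtoC (norm x) : C_AbsRing).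
set (d := RtoC (/ norm x) : C_AbsRing).
assert (Hc : abs c = norm x) by (unfold abs; simpl; unfold c;
  rewrite Cmod_R; apply Rabs_pos_eq; lra).
assert (Hd : abs d = / norm x).
{ unfold abs; simpl; unfold d; rewrite Cmod_R; apply Rabs_pos_eq.
  apply Rlt_le, Rinv_0_lt_compat, Hx. }
assert (Hcd : mult c d = one).
{ unfold c, d, mult, one; simpl; rewrite <- RtoC_mult.
  now rewrite Rinv_r. }
assert (E : x = scal c (scal d x)).
{ rewrite scal_assoc, Hcd; symmetry; apply scal_one. }
assert (Hn : norm (scal d x) <= 1).
{ apply Rle_trans with (1 := norm_scal d x).
  rewrite Hd, Rinv_l; lra. }
rewrite E at 1.
rewrite (linear_scal l (lin_linear l)).
apply Rle_trans with (1 := norm_scal c _).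
rewrite Hc, Rmult_comm.
apply Rmult_le_compat_r; [lra | now apply opnorm_unit].
Qed.

Definition Lin_AbelianMonoid_mixin : AbelianMonoid.mixin_of Lin.
Proof.
apply (AbelianMonoid.Mixin Lin Lin_plus Lin_zero).
- intros l m; apply Lin_ext; intros x; apply plus_comm.
- intros l m n; apply Lin_ext; intros x; apply plus_assoc.
- intros l; apply Lin_ext; intros x; apply plus_zero_r.
Defined.

Canonical Lin_AbelianMonoid := AbelianMonoid.Pack Lin Lin_AbelianMonoid_mixin Lin.

Definition Lin_AbelianGroup_mixin : AbelianGroup.mixin_of Lin_AbelianMonoid.
Proof.
apply (AbelianGroup.Mixin Lin_AbelianMonoid Lin_opp).
intros l; apply Lin_ext; intros x; exact (plus_opp_r (lin_fun l x)).
Defined.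

Canonical Lin_AbelianGroup := AbelianGroup.Pack Lin
  (AbelianGroup.Class Lin Lin_AbelianMonoid_mixin Lin_AbelianGroup_mixin) Lin.

Definition Lin_ModuleSpace_mixin : ModuleSpace.mixin_of C_AbsRing Lin_AbelianGroup.
Proof.
apply (ModuleSpace.Mixin C_AbsRing Lin_AbelianGroup Lin_scal).
- intros c d l; apply Lin_ext; intros x; exact (scal_assoc c d (lin_fun l x)).
- intros l; apply Lin_ext; intros x; exact (scal_one (lin_fun l x)).
- intros c l m; apply Lin_ext; intros x; exact (scal_distr_l c (lin_fun l x) (lin_fun m x)).
- intros c d l; apply Lin_ext; intros x; exact (scal_distr_r c d (lin_fun l x)).
Defined.

Canonical Lin_ModuleSpace := ModuleSpace.Pack C_AbsRing Lin
  (ModuleSpace.Class C_AbsRing Lin (AbelianGroup.class Lin_AbelianGroup)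
     Lin_ModuleSpace_mixin) Lin.

Lemma opnorm_triangle (l m : Lin) : opnorm (plus l m) <= opnorm l + opnorm m.
Proof.
apply opnorm_least; intros x Hx.
apply Rle_trans with (1 := norm_triangle (l x) (m x)).
apply Rplus_le_compat; now apply opnorm_unit.
Qed.

Lemma opnorm_scal (c : C_AbsRing) (l : Lin) : opnorm (scal c l) <= abs c * opnorm l.
Proof.
apply opnorm_least; intros x Hx.
apply Rle_trans with (1 := norm_scal c (l x)).
apply Rmult_le_compat_l; [apply abs_ge_0 | now apply opnorm_unit].
Qed.

Lemma opnorm_eq0 (l : Lin) : opnorm l = 0 -> l = zero.
Proof.
intros H; apply Lin_ext; intros x; apply norm_eq_zero.
apply Rle_antisym; [| apply norm_ge_0].
assert (h := opnorm_bound l x); rewrite H in h; lra.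
Qed.

Definition Lin_ball (l : Lin) (e : R) (m : Lin) : Prop := opnorm (minus m l) < e.

Definition Lin_UniformSpace_mixin : UniformSpace.mixin_of Lin.
Proof.
apply (UniformSpace.Mixin Lin Lin_zero Lin_ball).
- intros l e; unfold Lin_ball.
  apply Rle_lt_trans with 0; [| apply cond_pos].
  apply opnorm_least; intros x _.
  rewrite minus_eq_zero; apply Req_le, @norm_zero.
- intros l m e; unfold Lin_ball; intros H.
  apply Rle_lt_trans with (2 := H); apply opnorm_least; intros x Hx.
  apply Rle_trans with (2 := opnorm_unit (minus m l) x Hx).
  apply Req_le; change (norm (minus (l x) (m x)) = norm (minus (m x) (l x))).
  now rewrite <- norm_opp, opp_minus.
- intros l m n e1 e2; unfold Lin_ball; intros H1 H2.
  rewrite (minus_trans m n l).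
  apply Rle_lt_trans with (1 := opnorm_triangle _ _); lra.
Defined.

Canonical Lin_UniformSpace := UniformSpace.Pack Lin Lin_UniformSpace_mixin Lin.

Canonical Lin_NormedModuleAux := NormedModuleAux.Pack C_AbsRing Lin
  (NormedModuleAux.Class C_AbsRing Lin (ModuleSpace.class C_AbsRing Lin_ModuleSpace)
     Lin_UniformSpace_mixin) Lin.

Definition Lin_NormedModule_mixin :
  NormedModule.mixin_of C_AbsRing Lin_NormedModuleAux.
Proof.
apply (NormedModule.Mixin C_AbsRing Lin_NormedModuleAux opnorm 1).
- exact opnorm_triangle.
- exact opnorm_scal.
- intros l m e H; exact H.
- intros l m e H; rewrite Rmult_1_l; exact H.
- exact opnorm_eq0.
Defined.

Canonical Lin_NormedModule := NormedModule.Pack C_AbsRing Lin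
  (NormedModule.Class C_AbsRing Lin
     (NormedModuleAux.class C_AbsRing Lin_NormedModuleAux) Lin_NormedModule_mixin) Lin.

(** [Df f z] is an arbitrary bounded linear map where [f] is not
    differentiable; it only depends on the germ of [f] at [z]. *)
Definition Df (f : U -> V) (z : U) : Lin :=
  epsilon (inhabits Lin_zero) (fun l : Lin => filterdiff f (locally z) l).

End BoundedLinear.

Arguments lin_fun {U V} _ _.
Arguments lin_linear {U V} _.
Arguments opnorm {U V} _.
Arguments Df {U V} f z.

(** [Lk X k] is [L(X, L(X, ..., L(X, X)))], the space in which the [k]-th
    Fréchet derivative of a map [X -> X] takes its values; its elements are
    the curried bounded [k]-linear operators. *)
Fixpoint Lk (X : NormedModule C_AbsRing) (k : nat) : NormedModule C_AbsRing :=
  match k with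
  | O => X
  | S j => Lin_NormedModule X (Lk X j)
  end.

(** [T(v_0, ..., v_(k-1))]; the later entries of [v] are ignored. *)
Fixpoint mapply {X : NormedModule C_AbsRing} {k : nat} :
    Lk X k -> (nat -> X) -> X :=
  match k return Lk X k -> (nat -> X) -> X with
  | O => fun T _ => T
  | S j => fun T v => mapply (k := j) (lin_fun T (v O)) (fun i => v (S i))
  end.

(** Supremum of [|T(v_0, ..., v_(k-1))|] over the closed unit ball; it agrees with
    the iterated operator norm, see [mlnorm_norm]. *)
Definition mlnorm {X : NormedModule C_AbsRing} {k : nat} (T : Lk X k) : R :=
  real (Lub_Rbar (fun r => exists v : nat -> X,
    (forall i, norm (v i) <= 1) /\ r = norm (mapply T v))).

Lemma mapply_le {X : NormedModule C_AbsRing} {k : nat} (T : Lk X k) (v : nat -> X) :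
  (forall i, norm (v i) <= 1) -> norm (mapply T v) <= norm T.
Proof.
revert T v; induction k as [| k IH]; intros T v Hv; [apply Rle_refl |].
apply Rle_trans with (1 := IH (lin_fun T (v O)) _ (fun i => Hv (S i))).
exact (opnorm_unit _ _ T (v O) (Hv O)).
Qed.

Lemma norm_le_mapply {X : NormedModule C_AbsRing} {k : nat} (T : Lk X k) (M : R) :
  (forall v, (forall i, norm (v i) <= 1) -> norm (mapply T v) <= M) -> norm T <= M.
Proof.
revert T; induction k as [| k IH]; intros T H.
{ apply (H (fun _ => zero)); intros _; rewrite norm_zero; lra. }
apply (opnorm_least _ _ T); intros x Hx; apply IH; intros v Hv.
apply (H (fun i => match i with O => x | S j => v j end)).
now intros [| i].
Qed.

Lemma mlnorm_norm {X : NormedModule C_AbsRing} {k : nat} (T : Lk X k) :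
  mlnorm T = norm T.
Proof.
unfold mlnorm; rewrite (is_lub_Rbar_unique _ (norm T)); [reflexivity |].
split.
- intros r [v [Hv ->]]; exact (mapply_le T v Hv).
- intros b Hb.
  assert (H0 := Hb _ (ex_intro _ (fun _ : nat => zero : X) (conj
     (fun _ => Rle_trans _ _ _ (Req_le _ _ norm_zero) Rle_0_1) eq_refl))).
  destruct b as [b | |]; simpl in *; try easy.
  apply norm_le_mapply; intros v Hv; apply Hb; exists v; auto.
Qed.

Fixpoint Dk {X : NormedModule C_AbsRing} (f : X -> X) (k : nat) : X -> Lk X k :=
  match k return X -> Lk X k with
  | O => f
  | S j => Df (Dk f j)
  end.

(** [A_k = D^k f(0) / k!]; all these derivatives exist when [f] is holomorphic
    near 0, and are then symmetric. *)
Definition coef {X : NormedModule C_AbsRing} (f : X -> X) (k : nat) : Lk X k :=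
  scal (RtoC (/ INR (fact k)) : C_AbsRing) (Dk f k zero).

Definition A (alpha : R) : R :=
  if Rle_dec alpha (1 / 4) then (2 - alpha) * sqrt (1 - 2 * alpha) / sqrt (5 - 2 * alpha)
  else if Rle_dec alpha (2 / 5) then (2 - alpha) * (1 - alpha) / (2 + alpha)
  else if Rlt_dec alpha (1 / 2) then alpha
  else 1 - alpha.

(** Mappings [f : B -> X] are represented by total functions [X -> X]: the
    notions below only involve the values of [f] on the open set [B]. *)

Section Mappings.

Context {X : HilbertSpace}.

Definition B (z : X) : Prop := norm z < 1.

Definition image (f : X -> X) (D : X -> Prop) (w : X) : Prop :=
  exists z, D z /\ f z = w.

Definition holomorphic_on (D : X -> Prop) (f : X -> X) : Prop :=
  forall z, D z -> ex_filterdiff f (locally z).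

Definition connected (D : X -> Prop) : Prop :=
  ~ exists P Q : X -> Prop, open P /\ open Q /\
      (forall x, D x -> P x \/ Q x) /\
      (exists x, D x /\ P x) /\ (exists x, D x /\ Q x) /\
      (forall x, ~ (D x /\ P x /\ Q x)).

Definition domain (D : X -> Prop) : Prop :=
  (exists x, D x) /\ open D /\ connected D.

Definition biholomorphic (f : X -> X) : Prop :=
  holomorphic_on B f /\ domain (image f B) /\
  exists g : X -> X, (forall z, B z -> g (f z) = z) /\ holomorphic_on (image f B) g.

Definition normalized (f : X -> X) : Prop :=
  f zero = zero /\ filterdiff f (locally (zero : X)) (fun x => x).

Definition K_class (f : X -> X) : Prop :=
  biholomorphic f /\ normalized f /\
  forall z1 z2 (t : R), B z1 -> B z2 -> 0 <= t <= 1 ->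
    image f B (plus (scal (RtoC (1 - t) : C_AbsRing) (f z1))
                    (scal (RtoC t : C_AbsRing) (f z2))).

Definition Sstar_class (f : X -> X) : Prop :=
  biholomorphic f /\ normalized f /\
  forall z (t : R), B z -> 0 <= t <= 1 ->
    image f B (scal (RtoC t : C_AbsRing) (f z)).

(** [f(z) = z + sum_(k >= 2) A_k(z^k)] on [B]; the summation index is [j = k - 2]. *)
Definition has_expansion (f : X -> X) : Prop :=
  forall z, B z ->
    is_series (fun j : nat => mapply (coef f (j + 2)) (fun _ => z)) (minus (f z) z).

Definition SK (alpha : R) (f : X -> X) : Prop :=
  holomorphic_on B f /\ has_expansion f /\
  let u := fun j : nat => let k := (j + 2)%nat in
    INR k * (INR k - alpha) * mlnorm (coef f k) in
  ex_series u /\ Series u <= A alpha.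

Definition SS (alpha : R) (f : X -> X) : Prop :=
  holomorphic_on B f /\ has_expansion f /\
  let u := fun j : nat => let k := (j + 2)%nat in
    (INR k - alpha) * mlnorm (coef f k) in
  ex_series u /\ Series u <= A alpha.

End Mappings.

(* Main.v *)
Require Import Defs.
From Stdlib Require Import Reals.
From Stdlib Require Import Lra Lia List ClassicalEpsilon.
From Coquelicot Require Import Coquelicot.
Open Scope R_scope.

(** Write [f = id + h], with [h] the sum of the terms of order at least 2, and [a_k] for
    the norm of the coefficient of order [k].

    Reduction to [alpha = 0]. For [k >= 2] one has [k - alpha >= k (2 - alpha) / 2], and
    [A alpha <= (2 - alpha) / sqrt 5] on each of the four ranges ([A_bound]). So the two
    coefficient conditions imply that the sum of the [k a_k], respectively of the
    [k^2 a_k], is at most [2 / sqrt 5] ([weighted_coef_sum]). In both cases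
    [e = sum k a_k] is a Lipschitz constant of [h] smaller than 1, and the contraction
    principle ([perturbed_identity_solve]) solves [f z = w] near any point, in a ball whose
    radius is controlled. Thus [f] is injective and open, with a differentiable inverse
    (the [near_id] lemmas).

    Starlikeness. Let [s = sum a_k], so that [s <= e / 2] and [e^2 + s^2 <= 1]. If
    [f z' = t f z], then [f z] makes an angle at most [arcsin e] with [z - z'] and at most
    [arcsin s] with [z'], so [z - z'] and [z'] do not make an obtuse angle and
    [norm z' <= norm z] ([starlike_norm_le]). Preimages of [t f z] therefore never approach
    the boundary when [t] decreases from 1, and they exist for all [t] ([starlike_image]).

    Convexity. Given [x] and [y], put [m = (1 - t) x + t y] and
    [q = t (1 - t) |x - y|^2]. The point [(1 - t) f x + t f y] is at distance at most
    [b q / 2] from [f m], with [b = sum k (k - 1) a_k] ([higher_order_convexity_defect]);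
    as [b + e = sum k^2 a_k <= 1], it has a preimage at distance at most [q / 2] from [m].
    The parallelogram law keeps this ball inside the unit ball ([convex_image]).

    The equivalence. If [f] is the sum of a series of homogeneous polynomials [P_k] with
    summable norms, all its derivatives are obtained term by term
    ([termwise_derivative], [Dk_series]). Hence [g z = Df(z) z] is the sum of the [k P_k],
    by Euler's relation, and [D^k g(0) = k D^k f(0)] ([euler_coef]), which matches the
    two conditions. This settles one direction. In the other one summability is known
    only for [g]; the series with terms [1/k] times those of [g] has a sum [F] with
    [DF(z) z = Df(z) z], and a mapping with vanishing radial derivative is constant on
    radii ([radially_constant]), so [f = F]. *)

Local Notation NM := (NormedModule C_AbsRing).

(** * Equalities between linear combinations *)

(** An equation between linear combinations in a complex module follows from the
    equality of the coefficients of each atom; [vring] reifies both sides and leaves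
    these scalar equalities to [ring]. *)
Inductive lin_expr :=
| LVar (n : nat) | LZero | LPlus (a b : lin_expr) | LOpp (a : lin_expr)
| LScal (c : C) (a : lin_expr).

Fixpoint lin_eval {V : ModuleSpace C_AbsRing} (env : list V) (e : lin_expr) : V :=
  match e with
  | LVar n => nth n env zero
  | LZero => zero
  | LPlus a b => plus (lin_eval env a) (lin_eval env b)
  | LOpp a => opp (lin_eval env a)
  | LScal c a => scal (c : C_AbsRing) (lin_eval env a)
  end.

Fixpoint lin_coef (e : lin_expr) (i : nat) : C :=
  match e with
  | LVar n => if Nat.eqb n i then RtoC 1 else RtoC 0
  | LZero => RtoC 0
  | LPlus a b => Cplus (lin_coef a i) (lin_coef b i)
  | LOpp a => Copp (lin_coef a i)
  | LScal c a => Cmult c (lin_coef a i)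
  end.

Fixpoint lin_comb {V : ModuleSpace C_AbsRing} (env : list V) (c : nat -> C) : V :=
  match env with
  | nil => zero
  | x :: env' => plus (scal (c O : C_AbsRing) x) (lin_comb env' (fun i => c (S i)))
  end.

Lemma lin_comb_ext {V : ModuleSpace C_AbsRing} (env : list V) (c d : nat -> C) :
  (forall i, (i < length env)%nat -> c i = d i) -> lin_comb env c = lin_comb env d.
Proof.
revert c d; induction env as [| x env IH]; intros c d H; simpl; [reflexivity |].
rewrite (H O) by (simpl; lia); f_equal.
apply IH; intros i Hi; apply H; simpl; lia.
Qed.

Lemma lin_comb_zero {V : ModuleSpace C_AbsRing} (env : list V) :
  lin_comb env (fun _ => RtoC 0) = zero.
Proof.
induction env as [| x env IH]; simpl; [reflexivity |].
rewrite IH, plus_zero_r; exact (scal_zero_l x).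
Qed.

Lemma lin_comb_plus {V : ModuleSpace C_AbsRing} (env : list V) (c d : nat -> C) :
  lin_comb env (fun i => Cplus (c i) (d i)) = plus (lin_comb env c) (lin_comb env d).
Proof.
revert c d; induction env as [| x env IH]; intros c d; simpl.
{ now rewrite plus_zero_r. }
rewrite IH.
assert (E : scal (Cplus (c O) (d O) : C_AbsRing) x
            = plus (scal (c O : C_AbsRing) x) (scal (d O : C_AbsRing) x))
  by exact (scal_distr_r (c O : C_AbsRing) (d O) x).
rewrite E, <- !plus_assoc; f_equal.
rewrite !plus_assoc; f_equal; apply plus_comm.
Qed.

Lemma lin_comb_scal {V : ModuleSpace C_AbsRing} (env : list V) (k : C) (c : nat -> C) :
  lin_comb env (fun i => Cmult k (c i)) = scal (k : C_AbsRing) (lin_comb env c).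
Proof.
revert c; induction env as [| x env IH]; intros c; simpl.
{ now rewrite scal_zero_r. }
rewrite IH, scal_distr_l; f_equal; symmetry; exact (scal_assoc (k : C_AbsRing) (c O) x).
Qed.

Lemma lin_comb_var {V : ModuleSpace C_AbsRing} (env : list V) (n : nat) :
  lin_comb env (fun i => if Nat.eqb n i then RtoC 1 else RtoC 0) = nth n env zero.
Proof.
revert n; induction env as [| x env IH]; intros [| n]; simpl; try reflexivity.
- rewrite lin_comb_zero, plus_zero_r; exact (scal_one x).
- rewrite IH; etransitivity; [| apply plus_zero_l]; f_equal; exact (scal_zero_l x).
Qed.

Lemma lin_eval_comb {V : ModuleSpace C_AbsRing} (env : list V) (e : lin_expr) :
  lin_eval env e = lin_comb env (lin_coef e).
Proof.
induction e as [n | | a IHa b IHb | a IHa | c a IHa]; simpl.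
- symmetry; apply lin_comb_var.
- symmetry; apply lin_comb_zero.
- rewrite IHa, IHb; symmetry; apply lin_comb_plus.
- rewrite IHa, <- (scal_opp_one (lin_comb env (lin_coef a))), <- lin_comb_scal.
  apply lin_comb_ext; intros i _; unfold opp, one; simpl; ring.
- rewrite IHa; symmetry; apply lin_comb_scal.
Qed.

Fixpoint same_coefs (n : nat) (a b : lin_expr) : Prop :=
  match n with
  | O => True
  | S m => lin_coef a m = lin_coef b m /\ same_coefs m a b
  end.

Lemma lin_eval_eq {V : ModuleSpace C_AbsRing} (env : list V) (a b : lin_expr) :
  same_coefs (length env) a b -> lin_eval env a = lin_eval env b.
Proof.
intros H; rewrite !lin_eval_comb; apply lin_comb_ext; revert H.
generalize (length env) as n; induction n as [| n IH]; simpl; intros H i Hi; [lia |].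
destruct H as [H1 H2]; destruct (Nat.eq_dec i n) as [-> | Hn]; auto.
apply IH; auto; lia.
Qed.

Ltac l_mem x l :=
  match l with
  | nil => constr:(false)
  | x :: _ => constr:(true)
  | _ :: ?l' => l_mem x l'
  end.
Ltac l_index x l :=
  match l with
  | x :: _ => constr:(O)
  | _ :: ?l' => let n := l_index x l' in constr:(S n)
  end.
Ltac l_vars t l :=
  lazymatch t with
  | plus ?a ?b => let l1 := l_vars a l in l_vars b l1
  | minus ?a ?b => let l1 := l_vars a l in l_vars b l1
  | opp ?a => l_vars a l
  | scal _ ?a => l_vars a l
  | zero => l
  | _ => let b := l_mem t l in
         lazymatch b with true => l | false => constr:(t :: l) end
  end.
Ltac l_reify t l :=
  lazymatch t with
  | plus ?a ?b => let x := l_reify a l in let y := l_reify b l in constr:(LPlus x y)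
  | minus ?a ?b => let x := l_reify a l in let y := l_reify b l in constr:(LPlus x (LOpp y))
  | opp ?a => let x := l_reify a l in constr:(LOpp x)
  | scal ?c ?a => let x := l_reify a l in constr:(LScal c x)
  | zero => constr:(LZero)
  | _ => let n := l_index t l in constr:(LVar n)
  end.

(** Leaves the coefficient equalities as goals, for the cases where they need a
    side condition such as a nonzero denominator. *)
Ltac vgoals :=
  lazymatch goal with
  | |- @eq ?T ?a ?b =>
    let l0 := l_vars a (@nil T) in
    let l := l_vars b l0 in
    let ea := l_reify a l in
    let eb := l_reify b l in
    change (lin_eval l ea = lin_eval l eb);
    apply lin_eval_eq; cbn [length same_coefs lin_coef Nat.eqb]; repeat split
  end.
Ltac csolve := apply injective_projections; simpl; ring.
Ltac vring := vgoals; csolve.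

(** * Normed modules, derivatives and series *)

Section NormedFacts.
Context {V : NormedModule C_AbsRing}.

(** Only one inequality is an axiom of normed modules; the other one comes from
    scaling back by the inverse. *)
Lemma norm_scal_eq (c : C) (x : V) : norm (scal (c : C_AbsRing) x) = Cmod c * norm x.
Proof.
apply Rle_antisym; [exact (norm_scal (c : C_AbsRing) x) |].
destruct (Ceq_dec c (RtoC 0)) as [-> | Hc].
{ rewrite Cmod_0, Rmult_0_l; apply norm_ge_0. }
assert (Hm : 0 < Cmod c) by now apply Cmod_gt_0.
assert (E : x = scal (Cinv c : C_AbsRing) (scal (c : C_AbsRing) x)).
{ vgoals; field; exact Hc. }
assert (H := norm_scal (Cinv c : C_AbsRing) (scal (c : C_AbsRing) x)).
rewrite <- E in H; change (abs (/ c)%C) with (Cmod (/ c)) in H.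
rewrite Cmod_inv in H by exact Hc.
apply Rmult_le_reg_l with (/ Cmod c); [now apply Rinv_0_lt_compat |].
rewrite <- Rmult_assoc, Rinv_l, Rmult_1_l by lra; exact H.
Qed.

Lemma norm_scal_R (t : R) (x : V) : norm (scal (RtoC t : C_AbsRing) x) = Rabs t * norm x.
Proof. now rewrite norm_scal_eq, Cmod_R. Qed.

Lemma norm_scal_pos (t : R) (x : V) :
  0 <= t -> norm (scal (RtoC t : C_AbsRing) x) = t * norm x.
Proof. intros Ht; now rewrite norm_scal_R, Rabs_pos_eq. Qed.

Lemma norm_minus_self (x : V) : norm (minus x x) = 0.
Proof. replace (minus x x) with (zero : V) by vring; exact norm_zero. Qed.

Lemma eq_of_norm_minus (x y : V) : norm (minus x y) <= 0 -> x = y.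
Proof.
intros H; assert (E : minus x y = zero).
{ apply norm_eq_zero, Rle_antisym; [exact H | apply norm_ge_0]. }
assert (E' : x = plus (minus x y) y) by vring.
rewrite E' , E; exact (plus_zero_l y).
Qed.

Lemma norm_minus_sym (x y : V) : norm (minus x y) = norm (minus y x).
Proof. now rewrite <- norm_opp, opp_minus. Qed.

Lemma norm_minus_le (x y : V) : norm (minus x y) <= norm x + norm y.
Proof. rewrite <- (norm_opp y); apply norm_triangle. Qed.

Lemma norm_le_minus (x y : V) : norm x <= norm y + norm (minus x y).
Proof.
replace x with (plus y (minus x y)) at 1 by vring; apply norm_triangle.
Qed.

Lemma locally_iff (x : V) (P : V -> Prop) :
  locally x P <-> exists d, 0 < d /\ forall y, norm (minus y x) < d -> P y.
Proof.
split.
- intros H; destruct (locally_norm_le_locally x P H) as [d Hd].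
  exists d; split; [apply cond_pos | exact Hd].
- intros [d [Hd H]]; apply locally_le_locally_norm; exists (mkposreal d Hd); exact H.
Qed.

Lemma is_series_norm_le (a : nat -> V) (l : V) (b : nat -> R) (s : R) :
  is_series a l -> (forall n, norm (a n) <= b n) -> is_series b s -> norm l <= s.
Proof.
intros Ha Hab Hb.
apply (is_lim_seq_le (fun n => norm (sum_n a n)) (sum_n b) (norm l) s).
- intros n; apply Rle_trans with (sum_n (fun k => norm (a k)) n).
  + apply norm_sum_n_m.
  + apply sum_n_m_le, Hab.
- exact (filterlim_comp _ _ _ _ _ _ _ _ Ha (filterlim_norm l)).
- exact Hb.
Qed.

Lemma is_series_unique_gen (a : nat -> V) (l m : V) :
  is_series a l -> is_series a m -> l = m.
Proof. apply filterlim_locally_unique. Qed.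

Lemma is_series_eps (a : nat -> V) (l : V) :
  (forall e, 0 < e -> exists N, forall n, (N <= n)%nat -> norm (minus (sum_n a n) l) < e) ->
  is_series a l.
Proof.
intros H P HP; apply locally_iff in HP; destruct HP as [d [Hd HP]].
destruct (H d Hd) as [N HN]; exists N; intros n Hn; apply HP, HN, Hn.
Qed.

End NormedFacts.

Section TwoSpaces.
Context {U V : NormedModule C_AbsRing}.

Lemma filterdiff_iff (f l : U -> V) (x : U) :
  filterdiff f (locally x) l <->
  is_linear l /\ forall e, 0 < e -> exists d, 0 < d /\ forall y, norm (minus y x) < d ->
    norm (minus (minus (f y) (f x)) (l (minus y x))) <= e * norm (minus y x).
Proof.
split.
- intros [Hl H]; split; [exact Hl |]; intros e He.
  apply locally_iff, (H x (fun P HP => HP) (mkposreal e He)).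
- intros [Hl H]; split; [exact Hl |]; intros x' Hx' e.
  apply is_filter_lim_locally_unique in Hx'; subst x'.
  apply locally_iff, H, cond_pos.
Qed.

Lemma is_linear_minus (l m : U -> V) :
  is_linear l -> is_linear m -> is_linear (fun x => minus (l x) (m x)).
Proof. intros Hl Hm; exact (is_linear_add _ _ l _ Hl (is_linear_neg _ _ m Hm)). Qed.

Lemma linear_minus (l : U -> V) (x y : U) :
  is_linear l -> l (minus x y) = minus (l x) (l y).
Proof. intros Hl; unfold minus; now rewrite (linear_plus l Hl), (linear_opp l y Hl). Qed.

(** By homogeneity, smallness near 0 propagates to every vector: this is why Fréchet
    derivatives are unique. *)
Lemma small_linear_zero (m : U -> V) :
  is_linear m ->
  (forall e, 0 < e -> exists d, 0 < d /\ forall v, norm v < d -> norm (m v) <= e * norm v) ->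
  forall v, m v = zero.
Proof.
intros Hm H v; apply norm_eq_zero, Rle_antisym; [| apply norm_ge_0].
apply Rnot_lt_le; intros Hv.
assert (Hv0 : 0 < norm v).
{ destruct (Rle_lt_or_eq_dec 0 (norm v) (norm_ge_0 v)) as [h | h]; [exact h |].
  symmetry in h; apply norm_eq_zero in h; subst v.
  rewrite (linear_zero m Hm), norm_zero in Hv; lra. }
destruct (H (norm (m v) / norm v / 2)) as [d [Hd Hs]].
{ apply Rdiv_lt_0_compat; [apply Rdiv_lt_0_compat |]; lra. }
set (t := d / 2 / norm v).
assert (Ht : 0 < t) by (apply Rdiv_lt_0_compat; lra).
assert (E : t * norm v = d / 2) by (unfold t; field; lra).
specialize (Hs (scal (RtoC t : C_AbsRing) v)).
rewrite (linear_scal m Hm), !norm_scal_pos in Hs by lra.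
assert (Hs' := Hs ltac:(lra)).
replace (norm (m v) / norm v / 2 * (t * norm v)) with (t * norm (m v) / 2) in Hs'
  by (field; lra).
assert (0 < t * norm (m v)) by now apply Rmult_lt_0_compat.
lra.
Qed.

Lemma filterdiff_unique (f l m : U -> V) (x : U) :
  filterdiff f (locally x) l -> filterdiff f (locally x) m -> forall v, l v = m v.
Proof.
intros Hl Hm v.
apply filterdiff_iff in Hl; apply filterdiff_iff in Hm.
destruct Hl as [Ll Hl], Hm as [Lm Hm].
apply eq_of_norm_minus, Req_le; rewrite <- (@norm_zero _ V); f_equal.
{ apply (small_linear_zero (fun v => minus (l v) (m v))); [now apply is_linear_minus |].
  clear v; intros e He.
  destruct (Hl (e / 2)) as [d1 [Hd1 H1]]; [lra |].
  destruct (Hm (e / 2)) as [d2 [Hd2 H2]]; [lra |].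
  exists (Rmin d1 d2); split; [now apply Rmin_pos |]; intros v Hv.
  assert (Ev : minus (plus x v) x = v) by vring.
  specialize (H1 (plus x v)); specialize (H2 (plus x v)); rewrite Ev in H1, H2.
  assert (h1 := H1 (Rlt_le_trans _ _ _ Hv (Rmin_l _ _))).
  assert (h2 := H2 (Rlt_le_trans _ _ _ Hv (Rmin_r _ _))).
  replace (minus (l v) (m v)) with
    (minus (minus (minus (f (plus x v)) (f x)) (m v))
           (minus (minus (f (plus x v)) (f x)) (l v))) by vring.
  apply Rle_trans with (1 := norm_minus_le _ _); lra. }
Qed.

Lemma Df_correct (f : U -> V) (x : U) :
  ex_filterdiff f (locally x) -> filterdiff f (locally x) (Df f x).
Proof.
intros [l Hl]; unfold Df.
apply (epsilon_spec (inhabits (Lin_zero U V))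
  (fun l : Lin U V => filterdiff f (locally x) l)).
exists (mkLin U V l (proj1 Hl)); exact Hl.
Qed.

Lemma Df_unique (f : U -> V) (x : U) (l : Lin U V) :
  filterdiff f (locally x) l -> Df f x = l.
Proof.
intros Hl; apply Lin_ext; intros v.
apply (filterdiff_unique f _ _ x); [| exact Hl].
apply Df_correct; exists l; exact Hl.
Qed.

Lemma is_series_linear (l : U -> V) (a : nat -> U) (s : U) :
  is_linear l -> is_series a s -> is_series (fun n => l (a n)) (l s).
Proof.
intros Hl Ha; unfold is_series.
apply filterlim_ext with (fun n => l (sum_n a n)).
- intros n; induction n as [| n IH]; [now rewrite !sum_O |].
  now rewrite !sum_Sn, (linear_plus l Hl), IH.
- exact (filterlim_comp _ _ _ _ _ _ _ _ Ha 
    (filterdiff_continuous l s (ex_intro _ l (filterdiff_linear l Hl)))).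
Qed.

End TwoSpaces.



(** Completeness in the form in which it is used, and which passes from [V] to the
    bounded linear maps into [V], hence to all the spaces [Lk X k]. *)
Definition abs_complete (V : NormedModule C_AbsRing) : Prop :=
  forall (a : nat -> V) (b : nat -> R),
    (forall n, norm (a n) <= b n) -> ex_series b -> ex_series a.

Lemma sum_n_lin {U V : NormedModule C_AbsRing} (a : nat -> Lin U V) (n : nat) (x : U) :
  lin_fun (sum_n a n) x = sum_n (fun k => lin_fun (a k) x) n.
Proof.
induction n as [| n IH]; [now rewrite !sum_O |].
rewrite !sum_Sn, <- IH; reflexivity.
Qed.

Lemma is_series_tail {V : NormedModule C_AbsRing} (a : nat -> V) (l : V) (n : nat) :
  is_series a l -> is_series (fun k => a (S n + k)%nat) (minus l (sum_n a n)).
Proof.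
intros H; apply (is_series_incr_n a (S n)); [lia |].
change (is_series a (plus (minus l (sum_n a n)) (sum_n a n))).
assert (E : plus (minus l (sum_n a n)) (sum_n a n) = l) by vring.
rewrite E; exact H.
Qed.

(** The limit is the pointwise one; the tail of the majorant bounds the operator norm
    of the remainder uniformly on the unit ball. *)
Lemma abs_complete_Lin (U V : NormedModule C_AbsRing) :
  abs_complete V -> abs_complete (Lin_NormedModule U V).
Proof.
intros HV a b Hab [s Hb].
assert (Hb0 : forall n, 0 <= b n)
  by (intros n; apply Rle_trans with (2 := Hab n); apply (norm_ge_0 (a n))).
assert (Hx : forall n x, norm (lin_fun (a n) x) <= b n * norm x).
{ intros n x; apply Rle_trans with (1 := opnorm_bound _ _ (a n) x).
  apply Rmult_le_compat_r; [apply norm_ge_0 | exact (Hab n)]. }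
assert (Hs : forall x : U, exists y : V, is_series (fun n => lin_fun (a n) x) y).
{ intros x; apply (HV _ (fun n => b n * norm x)); [intros n; apply Hx |].
  apply ex_series_scal_r; now exists s. }
set (L := fun x => epsilon (inhabits zero) (fun y => is_series (fun n => lin_fun (a n) x) y)).
assert (HL : forall x, is_series (fun n => lin_fun (a n) x) (L x))
  by (intros x; apply epsilon_spec, Hs).
assert (Lin_L : is_linear L).
{ split.
  - intros x y; apply (is_series_unique_gen _ _ _ (HL _)).
    apply is_series_ext with (2 := is_series_plus _ _ _ _ (HL x) (HL y)).
    intros n; symmetry; apply (linear_plus _ (lin_linear (a n))).
  - intros k x; apply (is_series_unique_gen _ _ _ (HL _)).
    apply is_series_ext with (2 := is_series_scal k _ _ (HL x)).
    intros n; symmetry; apply (linear_scal _ (lin_linear (a n))).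
  - exists (s + 1); split.
    + assert (0 <= s); [| lra].
      rewrite <- (is_series_unique b s Hb).
      rewrite <- (Rmult_0_l (Series b)), <- Series_scal_l; apply Series_le.
      * intros n; specialize (Hb0 n); lra.
      * now exists s.
    + intros x; apply Rle_trans with (s * norm x).
      * apply (is_series_norm_le _ _ _ _ (HL x) (fun n => Hx n x)).
        apply (is_series_scal_r (norm x) b s Hb).
      * apply Rmult_le_compat_r; [apply norm_ge_0 | lra]. }
exists (mkLin U V L Lin_L); apply is_series_eps; intros e He.
assert (Hlim : is_lim_seq (sum_n b) s) by exact Hb.
apply is_lim_seq_spec in Hlim; destruct (Hlim (mkposreal e He)) as [N HN].
exists N; intros n Hn; specialize (HN n Hn); simpl in HN.
rewrite norm_minus_sym; apply Rle_lt_trans with (2 := HN).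
apply (opnorm_least U V (minus (mkLin U V L Lin_L) (sum_n a n))); intros x Hx1.
apply Rle_trans with (norm (minus (L x) (sum_n (fun k => lin_fun (a k) x) n))).
{ rewrite <- sum_n_lin; apply Rle_refl. }
rewrite Rabs_minus_sym; apply Rle_trans with (s - sum_n b n); [| apply Rle_abs].
apply (is_series_norm_le _ _ (fun k => b (S n + k)%nat) _
  (is_series_tail _ _ n (HL x))).
- intros k; apply Rle_trans with (1 := Hx _ x).
  rewrite <- (Rmult_1_r (b (S n + k)%nat)) at 2; now apply Rmult_le_compat_l.
- apply (is_series_incr_n b (S n)); [lia |].
  change (is_series b (s - sum_n b n + sum_n b n)).
  assert (E : s - sum_n b n + sum_n b n = s) by (simpl; ring).
  rewrite E; exact Hb.
Qed.

Lemma abs_complete_Lk (X : CompleteNormedModule C_AbsRing) (k : nat) :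
  abs_complete (Lk X k).
Proof.
induction k as [| k IH]; [exact (@ex_series_le C_AbsRing X) |].
now apply abs_complete_Lin.
Qed.

(** * Solving a perturbed identity *)

(** The solution is the fixed point of [z |-> w - h z], which maps the ball of centre
    [c] and radius [rho] to itself. The ball is chosen freely, so that each use controls
    where the solution lies. *)
Lemma perturbed_identity_solve {X : NormedModule C_AbsRing} (HX : abs_complete X)
    (h : X -> X) (k rho : R) (c w : X) :
  0 <= k < 1 ->
  (forall x y : X, norm (minus x c) <= rho -> norm (minus y c) <= rho ->
     norm (minus (h x) (h y)) <= k * norm (minus x y)) ->
  norm (minus w (plus c (h c))) <= (1 - k) * rho ->
  exists z : X, norm (minus z c) <= rho /\ plus z (h z) = w.
Proof.
intros Hk Hh Hw.
assert (HR : 0 <= rho).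
{ apply Rnot_lt_le; intros HR; assert (h0 := norm_ge_0 (minus w (plus c (h c)))).
  assert (0 < (1 - k) * - rho) by (apply Rmult_lt_0_compat; lra); lra. }
assert (Hcc : norm (minus c c) <= rho) by (rewrite norm_minus_self; exact HR).
set (u := fix u n := match n with O => c | S m => minus w (h (u m)) end).
assert (Hu : forall n, norm (minus (u n) c) <= rho).
{ induction n as [| n IH]; [exact Hcc |].
  replace (minus (u (S n)) c) with (minus (minus w (plus c (h c))) (minus (h (u n)) (h c)))
    by (simpl; vring).
  apply Rle_trans with (1 := norm_minus_le _ _).
  assert (h1 := Hh (u n) c IH Hcc).
  assert (k * norm (minus (u n) c) <= k * rho) by (apply Rmult_le_compat_l; lra).
  lra. }
set (a := (fun n => minus (u (S n)) (u n)) : nat -> X).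
assert (Ha : forall n, norm (a n) <= k ^ n * ((1 - k) * rho)).
{ induction n as [| n IH].
  - unfold a; simpl; rewrite Rmult_1_l; replace (minus (minus w (h c)) c) with
      (minus w (plus c (h c))) by vring; exact Hw.
  - replace (a (S n)) with (minus (h (u n)) (h (u (S n)))) by (unfold a; simpl; vring).
    apply Rle_trans with (1 := Hh _ _ (Hu n) (Hu (S n))).
    rewrite norm_minus_sym; fold (a n); simpl; rewrite Rmult_assoc.
    apply Rmult_le_compat_l; [lra | exact IH]. }
assert (Hsum : forall n, sum_n a n = minus (u (S n)) c).
{ induction n as [| n IH]; [now rewrite sum_O |].
  rewrite sum_Sn, IH; unfold a; vring. }
destruct (HX a _ Ha) as [s Hs].
{ apply (ex_series_scal_r ((1 - k) * rho) (fun n => k ^ n)), ex_series_geom.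
  rewrite Rabs_pos_eq; lra. }
exists (plus s c).
assert (Ez : minus (plus s c) c = s) by vring.
assert (HzR : norm (minus (plus s c) c) <= rho).
{ rewrite Ez.
  apply (is_lim_seq_le (fun n => norm (sum_n a n)) (fun _ => rho) (norm s) rho).
  - intros n; rewrite Hsum; apply Hu.
  - exact (filterlim_comp _ _ _ _ _ _ _ _ Hs (filterlim_norm s)).
  - apply is_lim_seq_const. }
split; [exact HzR |].
apply eq_of_norm_minus.
{ apply le_epsilon; intros e He.
  assert (Hloc : locally s (fun y => norm (minus y s) < e / 2)).
  { apply locally_iff; exists (e / 2); split; [lra | trivial]. }
  destruct (Hs _ Hloc) as [N HN].
  assert (H1 := HN N (Nat.le_refl N)); assert (H2 := HN (S N) ltac:(lia)).
  rewrite Hsum in H1, H2.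
  set (z := plus s c) in *.
  replace (minus (u (S N)) c) with (plus (minus (u (S N)) z) s) in H1 by (unfold z; vring).
  replace (minus (u (S (S N))) c) with (plus (minus (u (S (S N))) z) s) in H2
    by (unfold z; vring).
  replace (minus (plus (minus (u (S N)) z) s) s) with (minus (u (S N)) z) in H1 by vring.
  replace (minus (plus (minus (u (S (S N))) z) s) s) with (minus (u (S (S N))) z) in H2
    by vring.
  assert (Ew : minus (plus z (h z)) w =
    minus (minus (h z) (h (u (S N)))) (minus (u (S (S N))) z)) by (simpl; vring).
  rewrite Ew; apply Rle_trans with (1 := norm_minus_le _ _).
  assert (H3 := Hh z (u (S N)) HzR (Hu (S N))).
  rewrite (norm_minus_sym z) in H3.
  assert (h0 := norm_ge_0 (minus (u (S N)) z)).
  assert (k * norm (minus (u (S N)) z) <= 1 * norm (minus (u (S N)) z))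
    by (apply Rmult_le_compat_r; lra).
  lra. }
Qed.

(** * The real inner product *)

Section RealInner.
Context {HS : HilbertSpace}.

Local Notation X := (CompleteNormedModule.NormedModule C_AbsRing (hilbert_carrier HS)).

Definition rdot (x y : X) : R := Re (inner HS x y).

Lemma rdot_plus_l (x y z : X) : rdot (plus x y) z = rdot x z + rdot y z.
Proof. exact (f_equal fst (inner_plus HS x y z)). Qed.

Lemma rdot_scal_l (t : R) (x y : X) : rdot (scal (RtoC t : C_AbsRing) x) y = t * rdot x y.
Proof.
transitivity (Re (Cmult (RtoC t) (inner HS x y))); [exact (f_equal fst (inner_scal HS (RtoC t) x y)) |].
unfold rdot, Re, Cmult, RtoC; simpl; ring.
Qed.

Lemma rdot_sym (x y : X) : rdot x y = rdot y x.
Proof. exact (f_equal fst (inner_conj HS y x)). Qed.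

Lemma rdot_norm (x : X) : rdot x x = norm x * norm x.
Proof.
transitivity (norm x ^ 2); [exact (f_equal fst (inner_norm HS x)) | ring].
Qed.

Lemma rdot_opp_l (x y : X) : rdot (opp x) y = - rdot x y.
Proof.
replace (opp x) with (scal (RtoC (-1) : C_AbsRing) x) by vring.
rewrite rdot_scal_l; ring.
Qed.

Lemma rdot_minus_l (x y z : X) : rdot (minus x y) z = rdot x z - rdot y z.
Proof. unfold minus; rewrite rdot_plus_l, rdot_opp_l; ring. Qed.

Lemma rdot_plus_r (x y z : X) : rdot z (plus x y) = rdot z x + rdot z y.
Proof. now rewrite !(rdot_sym z), rdot_plus_l. Qed.

Lemma rdot_minus_r (x y z : X) : rdot z (minus x y) = rdot z x - rdot z y.
Proof. now rewrite !(rdot_sym z), rdot_minus_l. Qed.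

Lemma rdot_scal_r (t : R) (x y : X) : rdot y (scal (RtoC t : C_AbsRing) x) = t * rdot y x.
Proof. now rewrite !(rdot_sym y), rdot_scal_l. Qed.

Lemma rdot_ge0 (x : X) : 0 <= rdot x x.
Proof. rewrite rdot_norm; apply Rle_0_sqr. Qed.

Lemma rdot_cs (x y : X) : rdot x y * rdot x y <= rdot x x * rdot y y.
Proof.
assert (H := rdot_ge0 (minus (scal (RtoC (rdot y y) : C_AbsRing) x)
                             (scal (RtoC (rdot x y) : C_AbsRing) y))).
rewrite rdot_minus_l, !rdot_minus_r, !rdot_scal_l, !rdot_scal_r, (rdot_sym y x) in H.
destruct (Rle_lt_or_eq_dec 0 _ (rdot_ge0 y)) as [Hy | Hy].
- nra.
- assert (Ey : y = zero).
  { apply (@norm_eq_zero C_AbsRing X); rewrite rdot_norm in Hy; nra. }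
  subst y.
  assert (E : rdot x zero = 0).
  { replace (zero : X) with (scal (RtoC 0 : C_AbsRing) (zero : X)) by vring.
    rewrite rdot_scal_r; ring. }
  rewrite E; nra.
Qed.

Lemma rdot_bound (x y : X) : Rabs (rdot x y) <= norm x * norm y.
Proof.
apply Rsqr_incr_0_var; [| apply Rmult_le_pos; apply norm_ge_0].
rewrite <- Rsqr_abs; unfold Rsqr.
assert (H := rdot_cs x y); rewrite !rdot_norm in H; lra.
Qed.

Lemma norm_convex_comb (t : R) (x y : X) :
  let m := plus (scal (RtoC (1 - t) : C_AbsRing) x) (scal (RtoC t : C_AbsRing) y) in
  norm m * norm m = (1 - t) * (norm x * norm x) + t * (norm y * norm y)
    - t * (1 - t) * (norm (minus x y) * norm (minus x y)).
Proof.
intros m; unfold m; rewrite <- !rdot_norm.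
rewrite !rdot_plus_l, !rdot_plus_r, !rdot_minus_l, !rdot_minus_r,
  !rdot_scal_l, !rdot_scal_r, (rdot_sym y x); ring.
Qed.

(** Expand the square of the norm of [y + (x - y)]. *)
Lemma norm_le_of_obtuse (x y : X) : 0 <= rdot (minus x y) y -> norm y <= norm x.
Proof.
intros H; apply Rnot_lt_le; intros Hlt.
assert (H1 := rdot_ge0 (minus x y)); rewrite rdot_minus_l, !rdot_minus_r in H1.
rewrite rdot_minus_l in H; rewrite (rdot_sym y x) in H1; rewrite !rdot_norm in *.
assert (h := norm_ge_0 x); nra.
Qed.

(** The hypotheses say that [F] makes an angle at most [arcsin e] with [v] and at most
    [arcsin s] with [y]; these angles add up to at most a right angle. The proof
    compares, by Cauchy-Schwarz, the components of [F] and [y] orthogonal to [v]. *)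
Lemma angle_sum (F v y : X) (lam mu e s : R) :
  0 < lam -> 0 < mu -> 0 <= e < 1 -> 0 <= s -> e * e + s * s <= 1 ->
  norm (minus (scal (RtoC lam : C_AbsRing) F) v) <= e * norm v ->
  norm (minus (scal (RtoC mu : C_AbsRing) F) y) <= s * norm y ->
  0 <= rdot v y.
Proof.
intros Hlam Hmu He Hs Hes Hv Hy; apply Rnot_lt_le; intros Hc.
assert (CS := rdot_cs v y).
assert (Hv2 : rdot (minus (scal (RtoC lam : C_AbsRing) F) v)
                   (minus (scal (RtoC lam : C_AbsRing) F) v) <= e * e * rdot v v).
{ rewrite !rdot_norm.
  replace (e * e * (norm v * norm v)) with ((e * norm v) * (e * norm v)) by ring.
  apply Rmult_le_compat; trivial; apply norm_ge_0. }
assert (Hy2 : rdot (minus (scal (RtoC mu : C_AbsRing) F) y)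
                   (minus (scal (RtoC mu : C_AbsRing) F) y) <= s * s * rdot y y).
{ rewrite !rdot_norm.
  replace (s * s * (norm y * norm y)) with ((s * norm y) * (s * norm y)) by ring.
  apply Rmult_le_compat; trivial; apply norm_ge_0. }
assert (CS2 := rdot_cs
  (minus (scal (RtoC (rdot v v) : C_AbsRing) F) (scal (RtoC (rdot F v) : C_AbsRing) v))
  (minus (scal (RtoC (rdot v v) : C_AbsRing) y) (scal (RtoC (rdot v y) : C_AbsRing) v))).
repeat rewrite ?rdot_minus_l, ?rdot_minus_r, ?rdot_scal_l, ?rdot_scal_r in Hv2.
repeat rewrite ?rdot_minus_l, ?rdot_minus_r, ?rdot_scal_l, ?rdot_scal_r in Hy2.
repeat rewrite ?rdot_minus_l, ?rdot_minus_r, ?rdot_scal_l, ?rdot_scal_r in CS2.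
rewrite ?(rdot_sym v F), ?(rdot_sym y F), ?(rdot_sym y v) in *.
assert (hF := rdot_ge0 F); assert (hv := rdot_ge0 v); assert (hy := rdot_ge0 y).
set (n := rdot F F) in *; set (V := rdot v v) in *; set (Y := rdot y y) in *.
set (p := rdot F v) in *; set (q := rdot F y) in *; set (c := rdot v y) in *.
clearbody n V Y p q c; clear Hv Hy.
assert (HV : 0 < V) by nra.
assert (HY : 0 < Y) by nra.
assert (He2 : 0 < 1 - e * e) by nra.
assert (Hs2 : 0 <= 1 - s * s) by nra.
assert (Hp1 : lam * lam * n + (1 - e * e) * V <= 2 * lam * p) by lra.
assert (Hq1 : mu * mu * n + (1 - s * s) * Y <= 2 * mu * q) by lra.
assert (Hp : 0 < p).
{ assert (0 <= lam * lam * n) by (apply Rmult_le_pos; nra).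
  assert (0 < (1 - e * e) * V) by (apply Rmult_lt_0_compat; lra). nra. }
assert (Hq : 0 <= q).
{ assert (0 <= mu * mu * n) by (apply Rmult_le_pos; nra).
  assert (0 <= (1 - s * s) * Y) by (apply Rmult_le_pos; lra). nra. }
assert (amgm : forall l m K, 0 < l -> 0 <= m -> 0 <= K -> l * l * n + K <= 2 * l * m -> n * K <= m * m).
{ intros l m K Hl Hm HK Hlm.
  assert (0 <= l * l * n) by (apply Rmult_le_pos; nra).
  assert ((l * l * n + K) * (l * l * n + K) <= (2 * l * m) * (2 * l * m))
    by (apply Rmult_le_compat; lra).
  assert (l * l * (n * K) <= l * l * (m * m)).
  { assert (0 <= (l * l * n - K) * (l * l * n - K)) by apply Rle_0_sqr. lra. }
  apply Rmult_le_reg_l with (l * l); [nra | lra]. }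
assert (Hp2 := amgm lam p _ Hlam (Rlt_le _ _ Hp)
  (Rmult_le_pos _ _ (Rlt_le _ _ He2) hv) Hp1).
assert (Hq2 := amgm mu q _ Hmu Hq (Rmult_le_pos _ _ Hs2 hy) Hq1).
clear amgm Hp1 Hq1 Hv2 Hy2.
assert (HnY : 0 <= n * Y) by (apply Rmult_le_pos; lra).
assert (Hq3 : e * e * (n * Y) <= q * q).
{ apply Rle_trans with (2 := Hq2).
  apply Rle_trans with ((1 - s * s) * (n * Y)); [apply Rmult_le_compat_r; lra | right; ring]. }
assert (Hp3 : V * n - p * p <= e * e * (n * V)) by lra.
(* Cauchy-Schwarz for the components orthogonal to [v], scaled by [V]. *)
assert (CS3 : (V * q - c * p) * (V * q - c * p) <= (V * n - p * p) * (V * Y - c * c)).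
{ apply Rmult_le_reg_l with (V * V); [nra |].
  apply Rle_trans with (Rmult (V * (V * q - c * p)) (V * (V * q - c * p))); [right; ring |].
  apply Rle_trans with ((V * (V * n - p * p)) * (V * (V * Y - c * c))); [| right; ring].
  lra. }
assert (Hcp : 0 < - c * p) by (apply Rmult_lt_0_compat; lra).
assert (HVq : 0 <= V * q) by (apply Rmult_le_pos; lra).
assert (H1 : V * q * (V * q) < (V * q - c * p) * (V * q - c * p)) by nra.
assert (H2 : (V * n - p * p) * (V * Y - c * c) <= (e * e * (n * V)) * (V * Y)).
{ apply Rle_trans with (e * e * (n * V) * (V * Y - c * c)).
  - apply Rmult_le_compat_r; lra.
  - apply Rmult_le_compat_l; [| nra].
    repeat apply Rmult_le_pos; lra. }
assert (H3 : V * V * (e * e * (n * Y)) <= V * V * (q * q)) by (apply Rmult_le_compat_l; nra).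
lra.
Qed.

End RealInner.

(** * Bounded multilinear maps and their restriction to the diagonal *)

Lemma is_linear_intro {U V : NM} (l : U -> V) (M : R) :
  (forall x y : U, l (plus x y) = plus (l x) (l y)) ->
  (forall (k : C) (x : U), l (scal (k : C_AbsRing) x) = scal (k : C_AbsRing) (l x)) ->
  (forall x : U, norm (l x) <= M * norm x) -> is_linear l.
Proof.
intros H1 H2 H3; split; [exact H1 | exact H2 |].
exists (Rmax 1 M); split; [apply Rlt_le_trans with (1 := Rlt_0_1), Rmax_l |].
intros x; apply Rle_trans with (1 := H3 x), Rmult_le_compat_r; [apply norm_ge_0 | apply Rmax_r].
Qed.

Lemma opnorm_le {U V : NM} (l : Lin U V) (M : R) :
  0 <= M -> (forall x : U, norm (lin_fun l x) <= M * norm x) -> opnorm l <= M.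
Proof.
intros HM H; apply opnorm_least; intros x Hx.
apply Rle_trans with (1 := H x); rewrite <- (Rmult_1_r M) at 2; now apply Rmult_le_compat_l.
Qed.

Lemma lin_le {U V : NM} (l : Lin U V) (x : U) (a b : R) :
  opnorm l <= a -> norm x <= b -> norm (lin_fun l x) <= a * b.
Proof.
intros Ha Hb; apply Rle_trans with (1 := opnorm_bound _ _ l x).
apply Rmult_le_compat; trivial; [apply opnorm_ge0 | apply norm_ge_0].
Qed.

Definition Lin_comp {U V W : NM} (L : Lin V W) (l : Lin U V) : Lin U W :=
  mkLin U W _ (is_linear_comp _ _ (lin_linear l) (lin_linear L)).

Lemma Lin_comp_norm {U V W : NM} (L : Lin V W) (l : Lin U V) :
  opnorm (Lin_comp L l) <= opnorm L * opnorm l.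
Proof.
apply opnorm_le; [apply Rmult_le_pos; apply opnorm_ge0 |]; intros x; simpl.
rewrite Rmult_assoc; apply lin_le; [apply Rle_refl | apply opnorm_bound].
Qed.

Lemma postcomp_linear {U V W : NM} (L : Lin V W) :
  is_linear (U := Lin_NormedModule U V) (V := Lin_NormedModule U W) (Lin_comp L).
Proof.
apply (is_linear_intro (U := Lin_NormedModule U V) (V := Lin_NormedModule U W) _ (opnorm L)).
- intros x y; apply Lin_ext; intros u; exact (linear_plus _ (lin_linear L) _ _).
- intros k x; apply Lin_ext; intros u; exact (linear_scal _ (lin_linear L) _ _).
- intros x; apply Lin_comp_norm.
Qed.

Definition postcomp (U : NM) {V W : NM} (L : Lin V W) :
    Lin (Lin_NormedModule U V) (Lin_NormedModule U W) :=
  mkLin (Lin_NormedModule U V) (Lin_NormedModule U W) _ (postcomp_linear L).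

Lemma postcomp_norm {U V W : NM} (L : Lin V W) : opnorm (postcomp U L) <= opnorm L.
Proof. apply opnorm_le; [apply opnorm_ge0 |]; intros l; apply Lin_comp_norm. Qed.

Lemma flip_bound {U V W : NM} (T : Lin U (Lin_NormedModule V W)) (u : U) (v : V) :
  norm (lin_fun (lin_fun T u : Lin V W) v) <= opnorm T * norm v * norm u.
Proof.
apply Rle_trans with (opnorm T * norm u * norm v); [| right; ring].
apply lin_le; [apply (opnorm_bound _ _ T u) | apply Rle_refl].
Qed.

Lemma flip1_linear {U V W : NM} (T : Lin U (Lin_NormedModule V W)) (v : V) :
  is_linear (fun u : U => lin_fun (lin_fun T u : Lin V W) v).
Proof.
apply (is_linear_intro _ (opnorm T * norm v)).
- intros x y; now rewrite (linear_plus _ (lin_linear T)).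
- intros k x; now rewrite (linear_scal _ (lin_linear T)).
- intros u; apply flip_bound.
Qed.

Definition flip1 {U V W : NM} (T : Lin U (Lin_NormedModule V W)) (v : V) : Lin U W :=
  mkLin U W _ (flip1_linear T v).

Lemma flip2_linear {U V W : NM} (T : Lin U (Lin_NormedModule V W)) :
  is_linear (V := Lin_NormedModule U W) (flip1 T).
Proof.
apply (is_linear_intro (V := Lin_NormedModule U W) _ (opnorm T)).
- intros x y; apply Lin_ext; intros u; exact (linear_plus _ (lin_linear (lin_fun T u : Lin V W)) x y).
- intros k x; apply Lin_ext; intros u; exact (linear_scal _ (lin_linear (lin_fun T u : Lin V W)) k x).
- intros v; apply (opnorm_le (flip1 T v));
    [apply Rmult_le_pos; [apply opnorm_ge0 | apply norm_ge_0] | intros u; apply flip_bound].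
Qed.

Definition flip2 {U V W : NM} (T : Lin U (Lin_NormedModule V W)) :
    Lin V (Lin_NormedModule U W) :=
  mkLin V (Lin_NormedModule U W) _ (flip2_linear T).

Lemma flip2_norm {U V W : NM} (T : Lin U (Lin_NormedModule V W)) : opnorm (flip2 T) <= opnorm T.
Proof.
apply opnorm_le; [apply opnorm_ge0 |]; intros v; apply (opnorm_le (flip1 T v));
  [apply Rmult_le_pos; [apply opnorm_ge0 | apply norm_ge_0] | intros u; apply flip_bound].
Qed.

Lemma flip_linear {U V W : NM} :
  is_linear (U := Lin_NormedModule U (Lin_NormedModule V W))
            (V := Lin_NormedModule V (Lin_NormedModule U W)) flip2.
Proof.
apply (is_linear_intro (U := Lin_NormedModule U (Lin_NormedModule V W))
            (V := Lin_NormedModule V (Lin_NormedModule U W)) _ 1).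
- intros T1 T2; apply Lin_ext; intros v; apply Lin_ext; intros u; reflexivity.
- intros k T; apply Lin_ext; intros v; apply Lin_ext; intros u; reflexivity.
- intros T; rewrite Rmult_1_l; apply flip2_norm.
Qed.

Definition flip (U V W : NM) : Lin (Lin_NormedModule U (Lin_NormedModule V W))
    (Lin_NormedModule V (Lin_NormedModule U W)) :=
  mkLin (Lin_NormedModule U (Lin_NormedModule V W))
        (Lin_NormedModule V (Lin_NormedModule U W)) _ flip_linear.

Lemma flip_norm (U V W : NM) : opnorm (flip U V W) <= 1.
Proof. apply opnorm_le; [lra |]; intros T; rewrite Rmult_1_l; apply flip2_norm. Qed.

Definition Lin_id (U : NM) : Lin U U := mkLin U U _ is_linear_id.

Lemma Lin_id_norm (U : NM) : opnorm (Lin_id U) <= 1.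
Proof. apply opnorm_le; [lra |]; intros x; simpl; lra. Qed.


(** Curried bounded [n]-linear maps from [X] to an arbitrary target: the target has to
    vary, because a derivative of such a map on the diagonal takes its values in
    [Lin X V]. *)
Fixpoint ML (X V : NM) (n : nat) : NM :=
  match n with
  | O => V
  | S m => Lin_NormedModule X (ML X V m)
  end.

(** The homogeneous polynomial [T(z, ..., z)]. *)
Fixpoint diag {X V : NM} {n : nat} : ML X V n -> X -> V :=
  match n return ML X V n -> X -> V with
  | O => fun T _ => T
  | S m => fun T z => diag (n := m) (lin_fun T z) z
  end.

(** Used to read [z |-> (u |-> T(u, z, ..., z))], a part of the derivative of a
    polynomial, as a polynomial with operator values. *)
Fixpoint swap_in (X U V : NM) (n : nat) : Lin (Lin_NormedModule U (ML X V n))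
    (ML X (Lin_NormedModule U V) n) :=
  match n return Lin (Lin_NormedModule U (ML X V n)) (ML X (Lin_NormedModule U V) n) with
  | O => Lin_id (Lin_NormedModule U V)
  | S m => Lin_comp (postcomp X (swap_in X U V m)) (flip U X (ML X V m))
  end.

(** The derivative of [z |-> T(z, ..., z)], itself of the form [S(z, ..., z)] with [S]
    valued in [Lin X V]: the increment enters the first slot, or one of the others,
    with the first slot then filled by the point. *)
Fixpoint dML (X V : NM) (n : nat) : Lin (ML X V (S n)) (ML X (Lin_NormedModule X V) n) :=
  match n return Lin (ML X V (S n)) (ML X (Lin_NormedModule X V) n) with
  | O => Lin_id (Lin_NormedModule X V)
  | S m => Lin_plus (ML X V (S (S m))) (ML X (Lin_NormedModule X V) (S m))
      (swap_in X X V (S m)) (postcomp X (dML X V m))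
  end.

(** [Lk X n] and [ML X X n] are the same space, but only after case analysis on [n]. *)
Fixpoint ML_of_Lk (X : NM) (n : nat) : Lin (Lk X n) (ML X X n) :=
  match n return Lin (Lk X n) (ML X X n) with
  | O => Lin_id X
  | S m => postcomp X (ML_of_Lk X m)
  end.

Lemma swap_in_norm (X U V : NM) (n : nat) : opnorm (swap_in X U V n) <= 1.
Proof.
induction n as [| n IH]; [apply Lin_id_norm |].
apply Rle_trans with (1 := Lin_comp_norm _ _).
rewrite <- (Rmult_1_l 1); apply Rmult_le_compat; try apply opnorm_ge0.
- apply Rle_trans with (1 := postcomp_norm _); exact IH.
- apply flip_norm.
Qed.

Lemma dML_norm (X V : NM) (n : nat) : opnorm (dML X V n) <= INR (S n).
Proof.
induction n as [| n IH]; [apply Lin_id_norm |].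
rewrite S_INR, Rplus_comm.
apply Rle_trans with (1 := opnorm_triangle _ _ _ _); apply Rplus_le_compat.
- apply swap_in_norm.
- apply Rle_trans with (1 := postcomp_norm _); exact IH.
Qed.

Lemma ML_of_Lk_norm (X : NM) (n : nat) : opnorm (ML_of_Lk X n) <= 1.
Proof.
induction n as [| n IH]; [apply Lin_id_norm |].
apply Rle_trans with (1 := postcomp_norm _); exact IH.
Qed.

Lemma ML_of_Lk_le (X : NM) (n : nat) (T : Lk X n) : norm (lin_fun (ML_of_Lk X n) T) <= mlnorm T.
Proof.
rewrite mlnorm_norm, <- (Rmult_1_l (norm T)); apply lin_le; [apply ML_of_Lk_norm | apply Rle_refl].
Qed.

Lemma diag_ML_of_Lk (X : NM) (n : nat) (T : Lk X n) (z : X) :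
  diag (lin_fun (ML_of_Lk X n) T) z = mapply T (fun _ => z).
Proof. induction n as [| n IH]; [reflexivity | apply IH]. Qed.

Lemma diag_norm {X V : NM} {n : nat} (T : ML X V n) (z : X) :
  norm (diag T z) <= norm T * norm z ^ n.
Proof.
induction n as [| n IH]; simpl; [lra |].
apply Rle_trans with (1 := IH _).
rewrite <- Rmult_assoc; apply Rmult_le_compat_r; [apply pow_le, norm_ge_0 |].
apply (opnorm_bound _ _ T z).
Qed.

Lemma diag_le {X V : NM} {n : nat} (T : ML X V n) (z : X) (a r : R) :
  norm T <= a -> norm z <= r -> norm (diag T z) <= a * r ^ n.
Proof.
intros Ha Hr; apply Rle_trans with (1 := diag_norm T z).
apply Rmult_le_compat; trivial; try apply norm_ge_0; [apply pow_le, norm_ge_0 |].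
apply pow_incr; split; [apply norm_ge_0 | exact Hr].
Qed.

Lemma diag_plus {X V : NM} {n : nat} (T1 T2 : ML X V n) (z : X) :
  diag (plus T1 T2) z = plus (diag T1 z) (diag T2 z).
Proof. revert T1 T2; induction n as [| n IH]; intros T1 T2; [reflexivity | apply IH]. Qed.

Lemma diag_scal {X V : NM} {n : nat} (c : C) (T : ML X V n) (z : X) :
  diag (scal (c : C_AbsRing) T) z = scal (c : C_AbsRing) (diag T z).
Proof. revert T; induction n as [| n IH]; intros T; [reflexivity | apply IH]. Qed.

Lemma diag_minus {X V : NM} {n : nat} (T1 T2 : ML X V n) (z : X) :
  diag (minus T1 T2) z = minus (diag T1 z) (diag T2 z).
Proof. revert T1 T2; induction n as [| n IH]; intros T1 T2; [reflexivity | apply IH]. Qed.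

Lemma diag_zero {X V : NM} {n : nat} (T : ML X V (S n)) : diag T zero = zero.
Proof.
apply norm_eq_zero, Rle_antisym; [| apply norm_ge_0].
apply Rle_trans with (1 := diag_norm T zero); rewrite norm_zero; simpl; lra.
Qed.

Lemma diag_swap_in {X U V : NM} {n : nat} (T : Lin U (ML X V n)) (z : X) (u : U) :
  lin_fun (diag (lin_fun (swap_in X U V n) T) z : Lin U V) u = diag (lin_fun T u) z.
Proof.
revert T; induction n as [| n IH]; intros T; [reflexivity |].
change (lin_fun (diag (lin_fun (swap_in X U V n) (flip1 (T : Lin U (Lin_NormedModule X (ML X V n))) z)) z : Lin U V) u
  = diag (lin_fun T u) z).
now rewrite IH.
Qed.

Lemma diag_dML_S {X V : NM} {n : nat} (T : ML X V (S (S n))) (z u : X) :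
  lin_fun (diag (lin_fun (dML X V (S n)) T) z : Lin X V) u =
  plus (diag (lin_fun (T : Lin X (ML X V (S n))) u) z)
    (lin_fun (diag (lin_fun (dML X V n) (lin_fun (T : Lin X (ML X V (S n))) z)) z : Lin X V) u).
Proof.
transitivity (lin_fun (diag (plus (lin_fun (swap_in X X V (S n)) T)
   (lin_fun (postcomp X (dML X V n)) T)) z : Lin X V) u); [reflexivity |].
rewrite diag_plus; apply (f_equal2 plus (diag_swap_in (U := X) (n := S n) T z u)); reflexivity.
Qed.

(** Euler's relation for homogeneous polynomials. *)
Lemma diag_euler {X V : NM} {n : nat} (T : ML X V (S n)) (z : X) :
  lin_fun (diag (lin_fun (dML X V n) T) z : Lin X V) z
  = scal (RtoC (INR (S n)) : C_AbsRing) (diag T z).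
Proof.
induction n as [| n IH].
- simpl; symmetry; exact (scal_one _).
- rewrite diag_dML_S, IH, (S_INR (S n)).
  change (diag T z) with (diag (lin_fun (T : Lin X (ML X V (S n))) z) z).
  vring.
Qed.

(** Replace one argument at a time. *)
Lemma diag_lipschitz {X V : NM} {n : nat} (T : ML X V n) (x y : X) (r : R) :
  norm x <= r -> norm y <= r ->
  norm (minus (diag T x) (diag T y)) <= INR n * r ^ (n - 1) * norm T * norm (minus x y).
Proof.
intros Hx Hy; assert (Hr : 0 <= r) by (apply Rle_trans with (2 := Hx), norm_ge_0).
induction n as [| n IH].
{ simpl; rewrite norm_minus_self; lra. }
replace (minus (diag T x) (diag T y)) with
  (plus (minus (diag (lin_fun T x) x) (diag (lin_fun T x) y)) (diag (lin_fun T (minus x y)) y)).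
2: { rewrite (linear_minus _ _ _ (lin_linear T)), diag_minus; simpl; vring. }
apply Rle_trans with (1 := norm_triangle _ _).
assert (H1 := IH (lin_fun T x)).
assert (H2 := diag_le (lin_fun T (minus x y)) y _ r (opnorm_bound _ _ T (minus x y)) Hy).
assert (H3 : norm (lin_fun T x) <= norm T * r)
  by (apply lin_le; [apply Rle_refl | exact Hx]).
assert (H4 : INR n * r ^ (n - 1) * norm (lin_fun T x) * norm (minus x y)
   <= INR n * r ^ n * norm T * norm (minus x y)).
{ apply Rmult_le_compat_r; [apply norm_ge_0 |].
  apply Rle_trans with (INR n * r ^ (n - 1) * (norm T * r)).
  - apply Rmult_le_compat_l; [| exact H3].
    apply Rmult_le_pos; [apply pos_INR | now apply pow_le].
  - right; destruct n as [| n]; [simpl; ring |].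
    replace (S n - 1)%nat with n by lia; simpl; ring. }
change (norm T) with (opnorm T) in *.
replace (S n - 1)%nat with n by lia; rewrite S_INR.
apply Rle_trans with (1 := Rplus_le_compat _ _ _ _ (Rle_trans _ _ _ H1 H4) H2).
right; ring.
Qed.

(** Second order remainder, with the dependence on the radius that makes the series of
    the remainders converge inside the unit ball. *)
Lemma diag_taylor {X V : NM} {n : nat} (T : ML X V (S n)) (x y : X) (r : R) :
  norm x <= r -> norm y <= r ->
  norm (minus (minus (diag T y) (diag T x))
          (lin_fun (diag (lin_fun (dML X V n) T) x : Lin X V) (minus y x)))
  <= INR (S n) * (INR n * r ^ (n - 1)) * norm T * (norm (minus y x) * norm (minus y x)).
Proof.
intros Hx Hy; assert (Hr : 0 <= r) by (apply Rle_trans with (2 := Hx), norm_ge_0).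
set (d := norm (minus y x)).
assert (Hd : 0 <= d) by apply norm_ge_0.
induction n as [| n IH].
{ simpl; rewrite <- (linear_minus _ _ _ (lin_linear T)), norm_minus_self; lra. }
rewrite diag_dML_S.
set (Tx := lin_fun (T : Lin X (ML X V (S n))) x : ML X V (S n)).
set (Td := lin_fun (T : Lin X (ML X V (S n))) (minus y x) : ML X V (S n)).
assert (E : minus (minus (diag T y) (diag T x)) (plus (diag Td x)
    (lin_fun (diag (lin_fun (dML X V n) Tx) x : Lin X V) (minus y x))) =
  plus (minus (minus (diag Tx y) (diag Tx x))
      (lin_fun (diag (lin_fun (dML X V n) Tx) x : Lin X V) (minus y x)))
    (minus (diag Td y) (diag Td x))).
{ assert (E1 : diag T y = plus (diag Tx y) (diag Td y)).
  { unfold Tx, Td; rewrite <- diag_plus, <- (linear_plus _ (lin_linear T)).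
    assert (Ey : plus x (minus y x) = y) by vring.
    rewrite Ey; reflexivity. }
  rewrite E1; change (diag T x) with (diag Tx x); vring. }
rewrite E; apply Rle_trans with (1 := norm_triangle _ _).
assert (H1 := IH Tx).
assert (H2 := diag_lipschitz Td y x r Hy Hx); fold d in H2.
assert (H3 : norm Tx <= norm T * r) by (apply lin_le; [apply Rle_refl | exact Hx]).
assert (H4 : norm Td <= norm T * d) by (apply lin_le; apply Rle_refl).
replace (S n - 1)%nat with n in * by lia.
assert (H0 : 0 <= norm T) by apply (norm_ge_0 T).
assert (Hn := pos_INR n); assert (Hp := pow_le r n Hr).
assert (H5 : INR (S n) * (INR n * r ^ (n - 1)) * norm Tx * (d * d)
   <= INR (S n) * (INR n * r ^ n) * norm T * (d * d)).
{ apply Rmult_le_compat_r; [nra |].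
  apply Rle_trans with (INR (S n) * (INR n * r ^ (n - 1)) * (norm T * r)).
  - apply Rmult_le_compat_l; [| exact H3].
    repeat apply Rmult_le_pos; try apply pos_INR; now apply pow_le.
  - right; destruct n as [| n]; [simpl; ring |].
    replace (S n - 1)%nat with n by lia; simpl; ring. }
assert (H6 : INR (S n) * r ^ n * norm Td * d <= INR (S n) * r ^ n * (norm T * d) * d).
{ apply Rmult_le_compat_r; [exact Hd |]; apply Rmult_le_compat_l; [| exact H4].
  apply Rmult_le_pos; [apply pos_INR | exact Hp]. }
rewrite (S_INR (S n)); rewrite (S_INR n) in *.
assert (0 <= r ^ n * norm T * (d * d)) by (repeat apply Rmult_le_pos; lra).
assert (0 <= INR n * (r ^ n * norm T * (d * d))) by (apply Rmult_le_pos; lra).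
lra.
Qed.

(** The constant [n (n - 1) / 2] is half of the bound of the second derivative on the
    unit ball. Peeling off the first argument of [T] reduces the defect in degree [n + 1]
    to the one in degree [n] plus a Lipschitz increment of size [n], and the sum of
    these increments is the binomial coefficient. *)
Lemma diag_convexity_defect {X V : NM} {n : nat} (T : ML X V n) (x y : X) (t : R) :
  norm x <= 1 -> norm y <= 1 -> 0 <= t <= 1 ->
  norm (minus (plus (scal (RtoC (1 - t) : C_AbsRing) (diag T x))
                    (scal (RtoC t : C_AbsRing) (diag T y)))
     (diag T (plus (scal (RtoC (1 - t) : C_AbsRing) x) (scal (RtoC t : C_AbsRing) y))))
  <= INR n * (INR n - 1) / 2 * norm T *
     (t * (1 - t) * (norm (minus x y) * norm (minus x y))).
Proof.
intros Hx Hy Ht.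
set (m := plus (scal (RtoC (1 - t) : C_AbsRing) x) (scal (RtoC t : C_AbsRing) y) : X).
set (d := norm (minus x y)).
assert (Hm : norm m <= 1).
{ apply Rle_trans with (1 := norm_triangle _ _); rewrite !norm_scal_pos by lra; nra. }
assert (Hd : 0 <= d) by apply norm_ge_0.
set (q := t * (1 - t)).
assert (Hq : 0 <= q) by (apply Rmult_le_pos; lra).
induction n as [| n IH].
{ assert (G : forall v : V, norm (minus (plus (scal (RtoC (1 - t) : C_AbsRing) v)
      (scal (RtoC t : C_AbsRing) v)) v) = 0).
  { intros v; replace (minus (plus (scal (RtoC (1 - t) : C_AbsRing) v)
      (scal (RtoC t : C_AbsRing) v)) v) with (zero : V) by vring.
    exact norm_zero. }
  apply Rle_trans with 0; [right; exact (G T) | simpl; lra]. }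
set (Tm := lin_fun (T : Lin X (ML X V n)) m : ML X V n).
set (Td := lin_fun (T : Lin X (ML X V n)) (minus x y) : ML X V n).
assert (E : forall u, lin_fun (T : Lin X (ML X V n)) u =
   plus Tm (lin_fun (T : Lin X (ML X V n)) (minus u m))).
{ intros u; unfold Tm; rewrite <- (linear_plus _ (lin_linear T)).
  assert (Eu : plus m (minus u m) = u) by vring.
  now rewrite Eu. }
assert (Ex : diag T x = plus (diag Tm x) (scal (RtoC t : C_AbsRing) (diag Td x))).
{ simpl; rewrite E.
  assert (Eu : minus x m = scal (RtoC t : C_AbsRing) (minus x y)) by (unfold m; vring).
  rewrite Eu, (linear_scal _ (lin_linear T)), diag_plus.
  f_equal; exact (diag_scal _ _ _). }
assert (Ey : diag T y = plus (diag Tm y) (scal (RtoC (- (1 - t)) : C_AbsRing) (diag Td y))).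
{ simpl; rewrite E.
  assert (Eu : minus y m = scal (RtoC (- (1 - t)) : C_AbsRing) (minus x y))
    by (unfold m; vring).
  rewrite Eu, (linear_scal _ (lin_linear T)), diag_plus.
  f_equal; exact (diag_scal _ _ _). }
assert (Ed : minus (plus (scal (RtoC (1 - t) : C_AbsRing) (diag T x))
                    (scal (RtoC t : C_AbsRing) (diag T y))) (diag T m) =
  plus (minus (plus (scal (RtoC (1 - t) : C_AbsRing) (diag Tm x))
                    (scal (RtoC t : C_AbsRing) (diag Tm y))) (diag Tm m))
       (scal (RtoC q : C_AbsRing) (minus (diag Td x) (diag Td y)))).
{ rewrite Ex, Ey; change (diag T m) with (diag Tm m); unfold q; vring. }
rewrite Ed; apply Rle_trans with (1 := norm_triangle _ _).
rewrite norm_scal_pos by exact Hq.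
assert (H1 := IH Tm).
assert (H2 := diag_lipschitz Td x y 1 Hx Hy); fold d in H2; rewrite pow1, Rmult_1_r in H2.
assert (H3 : norm Tm <= norm T * 1) by (apply lin_le; [apply Rle_refl | exact Hm]).
assert (H4 : norm Td <= norm T * d) by (apply lin_le; apply Rle_refl).
assert (H0 : 0 <= norm T) by apply (norm_ge_0 T).
assert (Hn := pos_INR n).
assert (Hnn : 0 <= INR n * (INR n - 1) / 2).
{ destruct n as [| n]; [simpl; lra |]; rewrite S_INR; assert (h := pos_INR n); nra. }
assert (Hqd : 0 <= q * (d * d)) by (apply Rmult_le_pos; nra).
assert (H5 : INR n * (INR n - 1) / 2 * norm Tm * (q * (d * d)) <=
             INR n * (INR n - 1) / 2 * norm T * (q * (d * d))).
{ apply Rmult_le_compat_r; [exact Hqd |]; apply Rmult_le_compat_l; lra. }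
assert (H6 : q * norm (minus (diag Td x) (diag Td y)) <= q * (INR n * (norm T * d) * d)).
{ apply Rmult_le_compat_l; [exact Hq |]; apply Rle_trans with (1 := H2).
  apply Rmult_le_compat_r; [exact Hd |]; apply Rmult_le_compat_l; lra. }
rewrite S_INR; lra.
Qed.

(** * Term by term differentiation *)

Definition radius_ge1 (a : nat -> R) : Prop := Rbar_le 1 (CV_radius a).

Lemma radius_ge1_series (a : nat -> R) (r : R) :
  radius_ge1 a -> 0 <= r < 1 -> ex_series (fun n => a n * r ^ n).
Proof.
intros Ha Hr; apply ex_series_Rabs, CV_disk_inside.
apply Rbar_lt_le_trans with (Finite 1); [| exact Ha]; simpl; rewrite Rabs_pos_eq; lra.
Qed.

Lemma radius_ge1_derive (a : nat -> R) : radius_ge1 a -> radius_ge1 (PS_derive a).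
Proof. unfold radius_ge1; now rewrite CV_radius_derive. Qed.

Lemma radius_ge1_of_ex_series (a : nat -> R) : ex_series a -> radius_ge1 a.
Proof.
intros Ha; apply (proj1 (CV_radius_bounded a)).
assert (H := ex_series_lim_0 _ Ha).
destruct (filterlim_bounded a) as [M HM].
{ exists 0; exact H. }
exists M; intros n; rewrite pow1, Rmult_1_r; apply HM.
Qed.

Lemma radius_ge1_scal_n (a : nat -> R) : radius_ge1 a -> radius_ge1 (fun n => INR n * a n).
Proof.
intros Ha; unfold radius_ge1.
rewrite (CV_radius_ext _ (PS_incr_1 (PS_derive a))).
- rewrite CV_radius_incr_1, CV_radius_derive; exact Ha.
- intros [| n]; [unfold PS_incr_1; simpl; apply Rmult_0_l | reflexivity].
Qed.

Section Termwise.
Context {X V : NM} (HV : abs_complete V).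
Context (T : forall n, ML X V n) (a : nat -> R) (F : X -> V).
Context (Ha : forall n, norm (T n) <= a n).
Context (Hrad : radius_ge1 a).
Context (HF : forall z : X, norm z < 1 -> is_series (fun n => diag (T n) z) (F z)).

Lemma dML_term_norm (n : nat) : norm (lin_fun (dML X V n) (T (S n))) <= PS_derive a n.
Proof. apply lin_le; [apply dML_norm | apply Ha]. Qed.

(** The remainders of order two are summable on a ball of radius [r < 1] around the
    origin, since two formal derivations of the majorant leave its radius unchanged. *)
Lemma termwise_derivative : exists F' : X -> Lin X V, forall z : X, norm z < 1 ->
  is_series (V := Lin_NormedModule X V)
    (fun n => diag (lin_fun (dML X V n) (T (S n))) z) (F' z) /\
  filterdiff F (locally z) (F' z).
Proof.
assert (Hex : forall z : X, norm z < 1 -> exists l : Lin X V,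
   is_series (V := Lin_NormedModule X V)
     (fun n => diag (lin_fun (dML X V n) (T (S n))) z) l).
{ intros z Hz.
  apply (abs_complete_Lin X V HV _ (fun n => PS_derive a n * norm z ^ n)).
  - intros n; apply diag_le; [apply dML_term_norm | apply Rle_refl].
  - apply radius_ge1_series; [now apply radius_ge1_derive | split; [apply norm_ge_0 | exact Hz]]. }
exists (fun z => epsilon (inhabits (Lin_zero X V)) (fun l : Lin X V =>
   is_series (V := Lin_NormedModule X V)
     (fun n => diag (lin_fun (dML X V n) (T (S n))) z) l)).
intros z Hz; set (l := epsilon _ _).
assert (Hl : is_series (V := Lin_NormedModule X V)
   (fun n => diag (lin_fun (dML X V n) (T (S n))) z) l).
{ exact (epsilon_spec (inhabits (Lin_zero X V)) (fun l : Lin X V =>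
   is_series (V := Lin_NormedModule X V)
     (fun n => diag (lin_fun (dML X V n) (T (S n))) z) l) (Hex z Hz)). }
clearbody l; split; [exact Hl |].
apply filterdiff_iff; split; [exact (lin_linear l) |].
(* A radius strictly between [norm z] and 1, to leave room for the increments. *)
set (r := (1 + norm z) / 2).
assert (Hz0 := norm_ge_0 z).
assert (Hr : 0 <= r < 1) by (unfold r; lra).
set (b := fun n => INR n * PS_derive a n * r ^ (n - 1)).
assert (Hb : ex_series b).
{ apply ex_series_incr_1.
  apply ex_series_ext with (fun n => PS_derive (PS_derive a) n * r ^ n).
  - intros n; unfold b; simpl Nat.sub; rewrite Nat.sub_0_r; reflexivity.
  - apply radius_ge1_series; [| exact Hr]; now apply radius_ge1_derive, radius_ge1_derive. }
destruct Hb as [s Hs].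
assert (Hs0 : 0 <= s).
{ apply Rle_trans with (norm (zero : V)); [apply norm_ge_0 |].
  apply (is_series_norm_le (fun _ => zero) zero b s); [| | exact Hs].
  - apply is_series_eps; intros e He; exists O; intros n _.
    assert (E0 : sum_n (fun _ => zero : V) n = zero).
    { induction n as [| n IH]; [apply sum_O | rewrite sum_Sn, IH; apply plus_zero_l]. }
    rewrite E0, norm_minus_self; exact He.
  - intros n; rewrite norm_zero; unfold b; apply Rmult_le_pos; [| apply pow_le; lra].
    apply Rmult_le_pos; [apply pos_INR |].
    apply Rle_trans with (2 := dML_term_norm n), norm_ge_0. }
assert (HT : forall y, norm y <= r ->
   norm (minus (minus (F y) (F z)) (lin_fun l (minus y z)))
     <= s * (norm (minus y z) * norm (minus y z))).
{ intros y Hy.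
  assert (Hzr : norm z <= r) by (unfold r; lra).
  assert (S1 : forall w, norm w < 1 ->
    is_series (fun n => diag (T (S n)) w) (minus (F w) (diag (T O) z))).
  { intros w Hw; apply (is_series_incr_1 (fun n => diag (T n) w)).
    assert (E : plus (minus (F w) (diag (T O) z)) (diag (T O) w) = F w).
    { change (diag (T O) w) with (diag (T O) z); vring. }
    exact (eq_ind_r (is_series _) (HF w Hw) E). }
  assert (S2 : is_series (fun n => lin_fun (diag (lin_fun (dML X V n) (T (S n))) z : Lin X V)
      (minus y z)) (lin_fun l (minus y z))).
  { apply (is_series_linear (U := Lin_NormedModule X V)
      (fun m : Lin X V => lin_fun m (minus y z))); [| exact Hl].
    apply (is_linear_intro (U := Lin_NormedModule X V) _ (norm (minus y z))); try reflexivity.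
    intros m; rewrite Rmult_comm; apply opnorm_bound. }
  assert (S3 := is_series_minus _ _ _ _
    (is_series_minus _ _ _ _ (S1 y ltac:(lra)) (S1 z Hz)) S2).
  assert (E : minus (minus (F y) (F z)) (lin_fun l (minus y z)) =
     minus (minus (minus (F y) (diag (T O) z)) (minus (F z) (diag (T O) z)))
       (lin_fun l (minus y z))) by vring.
  rewrite E.
  apply (is_series_norm_le _ _ (fun n => b n * (norm (minus y z) * norm (minus y z))) _ S3).
  - intros n; apply Rle_trans with (1 := diag_taylor (T (S n)) z y r Hzr Hy).
    apply Rmult_le_compat_r; [apply Rle_0_sqr |].
    apply Rle_trans with (INR (S n) * (INR n * r ^ (n - 1)) * a (S n)).
    + apply Rmult_le_compat_l; [| apply Ha].
      repeat apply Rmult_le_pos; try apply pos_INR; apply pow_le; lra.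
    + right; unfold b, PS_derive; ring.
  - apply (is_series_scal_r _ b s Hs). }
intros e He.
set (d := Rmin (r - norm z) (e / (s + 1))).
assert (Hd : 0 < d).
{ apply Rmin_pos; [unfold r; lra | apply Rdiv_lt_0_compat; lra]. }
exists d; split; [exact Hd |]; intros y Hy.
assert (H1 : norm (minus y z) < r - norm z) by (apply Rlt_le_trans with (1 := Hy), Rmin_l).
assert (H2 : norm (minus y z) < e / (s + 1)) by (apply Rlt_le_trans with (1 := Hy), Rmin_r).
assert (Hyr : norm y <= r) by (assert (h := norm_le_minus y z); lra).
apply Rle_trans with (1 := HT y Hyr).
rewrite <- Rmult_assoc; apply Rmult_le_compat_r; [apply norm_ge_0 |].
apply Rle_trans with ((s + 1) * (e / (s + 1))); [| right; field; lra].
assert (h := norm_ge_0 (minus y z)); apply Rmult_le_compat; lra.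
Qed.

End Termwise.

Fixpoint iter_dML {X : NM} (T : forall n, ML X X n) (j : nat) : forall n, ML X (Lk X j) n :=
  match j return forall n, ML X (Lk X j) n with
  | O => T
  | S i => fun n => lin_fun (dML X (Lk X i) n) (iter_dML T i (S n))
  end.

Fixpoint PS_derives (a : nat -> R) (j : nat) : nat -> R :=
  match j with O => a | S i => PS_derive (PS_derives a i) end.

Lemma is_series_first {V : NM} (a : nat -> V) (l : V) :
  is_series a l -> (forall n, a (S n) = zero) -> l = a O.
Proof.
intros Hl H; apply (is_series_unique_gen a); [exact Hl |].
apply is_series_eps; intros e He; exists O; intros n _.
assert (E : sum_n a n = a O).
{ induction n as [| n IH]; [apply sum_O | rewrite sum_Sn, IH, H; apply plus_zero_r]. }
rewrite E, norm_minus_self; exact He.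
Qed.

Section Expansion.
Context {X : NM} (HX : forall k, abs_complete (Lk X k)).
Context (T : forall n, ML X X n) (a : nat -> R) (f : X -> X).
Context (Ha : forall n, norm (T n) <= a n).
Context (Hrad : radius_ge1 a).
Context (Hf : forall z : X, norm z < 1 -> is_series (fun n => diag (T n) z) (f z)).

Lemma iter_dML_norm (j n : nat) : norm (iter_dML T j n) <= PS_derives a j n.
Proof.
revert n; induction j as [| j IH]; intros n; [apply Ha |].
exact (dML_term_norm (iter_dML T j) (PS_derives a j) IH n).
Qed.

Lemma radius_ge1_derives (j : nat) : radius_ge1 (PS_derives a j).
Proof. induction j as [| j IH]; [exact Hrad | now apply radius_ge1_derive]. Qed.

Lemma Dk_series (j : nat) (z : X) : norm z < 1 ->
  is_series (fun n => diag (iter_dML T j n) z) (Dk f j z).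
Proof.
revert z; induction j as [| j IH]; intros z Hz; [now apply Hf |].
destruct (termwise_derivative (HX j) (iter_dML T j) (PS_derives a j) (Dk f j)
   (iter_dML_norm j) (radius_ge1_derives j) IH) as [F' HF'].
destruct (HF' z Hz) as [H1 H2].
change (Dk f (S j) z) with (Df (Dk f j) z).
rewrite (Df_unique _ _ _ H2); exact H1.
Qed.

(** At the origin only the term of degree 0 of the [j]-th derived series survives. *)
Lemma Dk_zero (j : nat) : Dk f j zero = iter_dML T j O.
Proof.
assert (H := Dk_series j zero).
rewrite norm_zero in H; specialize (H Rlt_0_1).
exact (is_series_first _ _ H (fun n => diag_zero _)).
Qed.

Lemma expansion_differentiable (z : X) : norm z < 1 -> ex_filterdiff f (locally z).
Proof.
intros Hz; destruct (termwise_derivative (V := X) (HX O) T a f Ha Hrad Hf) as [F' HF'].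
exists (F' z); apply HF', Hz.
Qed.

Lemma euler_series (z : X) : norm z < 1 ->
  is_series (fun n => diag (scal (RtoC (INR n) : C_AbsRing) (T n)) z) (lin_fun (Df f z) z).
Proof.
intros Hz; destruct (termwise_derivative (V := X) (HX O) T a f Ha Hrad Hf) as [F' HF'].
destruct (HF' z Hz) as [H1 H2]; rewrite (Df_unique _ _ _ H2).
assert (S2 : is_series (fun n => lin_fun (diag (lin_fun (dML X X n) (T (S n))) z : Lin X X)
      z) (lin_fun (F' z) z)).
{ apply (is_series_linear (U := Lin_NormedModule X X)
    (fun m : Lin X X => lin_fun m z)); [| exact H1].
  apply (is_linear_intro (U := Lin_NormedModule X X) _ (norm z)); try reflexivity.
  intros m; rewrite Rmult_comm; apply opnorm_bound. }
apply is_series_decr_1.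
assert (E : plus (lin_fun (F' z) z)
   (opp (diag (scal (RtoC (INR 0) : C_AbsRing) (T O)) z)) = lin_fun (F' z) z).
{ rewrite diag_scal; simpl; vring. }
refine (eq_ind_r (is_series _) _ E); apply is_series_ext with (2 := S2).
intros n; rewrite diag_euler, diag_scal; reflexivity.
Qed.

End Expansion.

(** Weighting the term of degree [m] by [m] weights the coefficient of degree [n] in the
    [j]-th derivative by [j + n], the degree from which it comes. *)
Lemma iter_dML_scal {X : NM} (T : forall n, ML X X n) (j n : nat) :
  iter_dML (fun n => scal (RtoC (INR n) : C_AbsRing) (T n)) j n
  = scal (RtoC (INR (j + n)) : C_AbsRing) (iter_dML T j n).
Proof.
revert n; induction j as [| j IH]; intros n; [reflexivity |].
simpl iter_dML; rewrite IH; replace (j + S n)%nat with (S j + n)%nat by lia.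
exact (linear_scal _ (lin_linear (dML X (Lk X j) n)) _ _).
Qed.

Section EulerOperator.
Context {X : NM} (HX : forall k, abs_complete (Lk X k)).
Context (T : forall n, ML X X n) (a : nat -> R) (f : X -> X).
Context (Ha : forall n, norm (T n) <= a n).
Context (Hrad : radius_ge1 a).
Context (Hf : forall z : X, norm z < 1 -> is_series (fun n => diag (T n) z) (f z)).

Lemma scal_n_norm (n : nat) : norm (scal (RtoC (INR n) : C_AbsRing) (T n)) <= INR n * a n.
Proof.
rewrite norm_scal_pos by apply pos_INR.
apply Rmult_le_compat_l; [apply pos_INR | apply Ha].
Qed.

Lemma euler_differentiable (z : X) : norm z < 1 ->
  ex_filterdiff (fun z => lin_fun (Df f z) z) (locally z).
Proof.
apply (expansion_differentiable HX (fun n => scal (RtoC (INR n) : C_AbsRing) (T n))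
  (fun n => INR n * a n)); [apply scal_n_norm | now apply radius_ge1_scal_n |].
intros w Hw; exact (euler_series HX T a f Ha Hrad Hf w Hw).
Qed.

(** The [k]-th derivative at 0 is a linear function of the term of degree [k] alone, and
    these terms are [k T_k] for the Euler derivative and [T_k] for [f]. *)
Lemma euler_coef (k : nat) :
  coef (fun z => lin_fun (Df f z) z) k = scal (RtoC (INR k) : C_AbsRing) (coef f k).
Proof.
unfold coef; rewrite (Dk_zero HX T a f Ha Hrad Hf).
rewrite (Dk_zero HX (fun n => scal (RtoC (INR n) : C_AbsRing) (T n))
  (fun n => INR n * a n) _ scal_n_norm (radius_ge1_scal_n a Hrad)
  (euler_series HX T a f Ha Hrad Hf)).
rewrite iter_dML_scal, Nat.add_0_r; vring.
Qed.

End EulerOperator.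

(** * Mappings close to the identity *)

Section NearIdentity.
Context {X : NM} (HX : abs_complete X).
Context (f : X -> X) (e : R).
Context (He : 0 <= e < 1).
Context (Hf : forall x y : X, norm x < 1 -> norm y < 1 ->
  norm (minus (minus (f x) x) (minus (f y) y)) <= e * norm (minus x y)).

Lemma near_id_expanding (x y : X) : norm x < 1 -> norm y < 1 ->
  (1 - e) * norm (minus x y) <= norm (minus (f x) (f y)).
Proof.
intros Hx Hy; assert (H := Hf x y Hx Hy).
assert (E : minus x y = minus (minus (f x) (f y)) (minus (minus (f x) x) (minus (f y) y)))
  by vring.
assert (H2 := norm_minus_le (minus (f x) (f y)) (minus (minus (f x) x) (minus (f y) y))).
rewrite <- E in H2; lra.
Qed.

Lemma near_id_injective (x y : X) : norm x < 1 -> norm y < 1 -> f x = f y -> x = y.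
Proof.
intros Hx Hy E; apply eq_of_norm_minus.
assert (H := near_id_expanding x y Hx Hy); rewrite E, norm_minus_self in H.
apply Rmult_le_reg_l with (1 - e); lra.
Qed.

Lemma near_id_solve (z0 w : X) (rho : R) : norm z0 + rho < 1 ->
  norm (minus w (f z0)) <= (1 - e) * rho ->
  exists z : X, norm (minus z z0) <= rho /\ norm z < 1 /\ f z = w.
Proof.
intros HR Hw.
assert (Hin : forall z, norm (minus z z0) <= rho -> norm z < 1).
{ intros z Hz; assert (h := norm_le_minus z z0); lra. }
destruct (perturbed_identity_solve HX (fun z => minus (f z) z) e rho z0 w He) as [z [H1 H2]].
- intros x y Hx Hy; apply Hf; now apply Hin.
- assert (E : minus w (plus z0 (minus (f z0) z0)) = minus w (f z0)) by vring.
  rewrite E; exact Hw.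
- exists z; split; [exact H1 |]; split; [now apply Hin |].
  rewrite <- H2; vring.
Qed.

Lemma near_id_open (w : X) : (exists z : X, norm z < 1 /\ f z = w) ->
  locally w (fun w' => exists z : X, norm z < 1 /\ f z = w').
Proof.
intros [z0 [Hz0 <-]]; apply locally_iff.
exists ((1 - e) * ((1 - norm z0) / 2)); split; [apply Rmult_lt_0_compat; lra |].
intros w Hw; destruct (near_id_solve z0 w ((1 - norm z0) / 2)) as [z [_ Hz]];
  [lra | lra | now exists z].
Qed.

(** The Lipschitz bound of [f - id] passes to its derivative, which makes the latter
    invertible. *)
Lemma near_id_linear (z0 : X) (l : X -> X) : norm z0 < 1 ->
  filterdiff f (locally z0) l -> forall v : X, norm (minus (l v) v) <= e * norm v.
Proof.
intros Hz0 Hl v; apply filterdiff_iff in Hl; destruct Hl as [Ll Hl].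
destruct (Req_dec (norm v) 0) as [Hv | Hv].
{ apply norm_eq_zero in Hv; subst v.
  rewrite (linear_zero l Ll), norm_minus_self, norm_zero; lra. }
assert (Hv0 : 0 < norm v) by (assert (h := norm_ge_0 v); lra).
apply le_epsilon; intros d Hd.
destruct (Hl (d / norm v)) as [d1 [Hd1 H1]]; [now apply Rdiv_lt_0_compat |].
set (m := Rmin d1 (1 - norm z0)).
assert (Hm : 0 < m) by (apply Rmin_pos; lra).
set (t := m / 2 / norm v).
assert (Ht : 0 < t) by (apply Rdiv_lt_0_compat; lra).
assert (Etv : t * norm v = m / 2) by (unfold t; field; lra).
set (y := plus z0 (scal (RtoC t : C_AbsRing) v) : X).
assert (Ey : minus y z0 = scal (RtoC t : C_AbsRing) v) by (unfold y; vring).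
assert (Ny : norm (minus y z0) = m / 2) by (rewrite Ey, norm_scal_pos; lra).
assert (Hm1 : m <= d1) by apply Rmin_l.
assert (Hm2 : m <= 1 - norm z0) by apply Rmin_r.
assert (h1 := H1 y ltac:(lra)).
assert (Hy : norm y < 1) by (assert (h := norm_le_minus y z0); lra).
assert (h2 := Hf y z0 Hy Hz0).
assert (E : scal (RtoC t : C_AbsRing) (minus (l v) v) =
   minus (minus (minus (f y) y) (minus (f z0) z0))
         (minus (minus (f y) (f z0)) (l (minus y z0)))).
{ rewrite Ey, (linear_scal l Ll); unfold y; vring. }
assert (h3 := norm_minus_le (minus (minus (f y) y) (minus (f z0) z0))
         (minus (minus (f y) (f z0)) (l (minus y z0)))).
rewrite <- E, norm_scal_pos in h3 by lra.
rewrite Ny in *.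
apply Rmult_le_reg_l with t; [exact Ht |].
replace (t * (e * norm v + d)) with (e * (t * norm v) + d / norm v * (t * norm v))
  by (field; lra).
rewrite Etv; lra.
Qed.

Lemma near_id_inverse (l : X -> X) : is_linear l ->
  (forall v : X, norm (minus (l v) v) <= e * norm v) ->
  exists m : Lin X X, (forall v, lin_fun m (l v) = v) /\
    forall w, norm (lin_fun m w) <= / (1 - e) * norm w.
Proof.
intros Ll Hl.
assert (Hexp : forall v, norm v <= / (1 - e) * norm (l v)).
{ intros v; apply Rmult_le_reg_l with (1 - e); [lra |].
  rewrite <- Rmult_assoc, Rinv_r, Rmult_1_l by lra.
  assert (h := norm_le_minus v (l v)); rewrite norm_minus_sym in h.
  specialize (Hl v); lra. }
assert (Hinj : forall u v, l u = l v -> u = v).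
{ intros u v E; apply eq_of_norm_minus; apply Rle_trans with (1 := Hexp _).
  rewrite (linear_minus l _ _ Ll), E, norm_minus_self; lra. }
assert (Hsurj : forall w, exists v, l v = w).
{ intros w.
  destruct (perturbed_identity_solve HX (fun v => minus (l v) v) e (/ (1 - e) * norm w) zero w He)
    as [v [_ Hv]].
  - intros x y _ _.
    assert (E : minus (minus (l x) x) (minus (l y) y) = minus (l (minus x y)) (minus x y)).
    { rewrite (linear_minus l _ _ Ll); vring. }
    rewrite E; apply Hl.
  - assert (E : minus w (plus zero (minus (l zero) zero)) = w).
    { rewrite (linear_zero l Ll); vring. }
    apply Rle_trans with (norm w); [right; exact (f_equal norm E) |].
    rewrite <- Rmult_assoc, Rinv_r by lra; lra.
  - exists v; rewrite <- Hv; vring. }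
set (m := fun w => epsilon (inhabits zero) (fun v => l v = w)).
assert (Hm : forall w, l (m w) = w) by (intros w; apply epsilon_spec, Hsurj).
assert (Hml : forall w, norm (m w) <= / (1 - e) * norm w).
{ intros w; rewrite <- (Hm w) at 2; apply Hexp. }
assert (Lm : is_linear m).
{ apply (is_linear_intro m (/ (1 - e))); [| | exact Hml].
  - intros x y; apply Hinj; now rewrite (linear_plus l Ll), !Hm.
  - intros k x; apply Hinj; now rewrite (linear_scal l Ll), !Hm. }
exists (mkLin X X m Lm); split; [| exact Hml].
intros v; apply Hinj, Hm.
Qed.

(** With [m] the inverse of the derivative [l], the error
    [g w - g w0 - m (w - w0)] is [- m (f z - f z0 - l (z - z0))], and [g] is
    Lipschitz. *)
Lemma near_id_inverse_diff (g : X -> X) (z0 : X) : norm z0 < 1 ->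
  (forall z : X, norm z < 1 -> g (f z) = z) ->
  ex_filterdiff f (locally z0) -> ex_filterdiff g (locally (f z0)).
Proof.
intros Hz0 Hg [l Hl].
assert (Hlin := near_id_linear z0 l Hz0 Hl).
assert (Ll := proj1 Hl).
destruct (near_id_inverse l Ll Hlin) as [m [Hm1 Hm2]].
exists m; apply filterdiff_iff; split; [exact (lin_linear m) |].
apply filterdiff_iff in Hl; destruct Hl as [_ Hl].
intros d Hd; set (k := / (1 - e)).
assert (Hk : 0 < k) by (apply Rinv_0_lt_compat; lra).
destruct (Hl (d / (k * k))) as [d1 [Hd1 H1]].
{ apply Rdiv_lt_0_compat; [exact Hd | now apply Rmult_lt_0_compat]. }
set (r := Rmin d1 (1 - norm z0) / 2).
assert (Hr : 0 < r) by (assert (h := Rmin_pos d1 (1 - norm z0) Hd1 ltac:(lra)); unfold r; lra).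
assert (Hr1 : r < d1) by (assert (h := Rmin_l d1 (1 - norm z0)); unfold r in *; lra).
assert (Hr2 : norm z0 + r < 1) by (assert (h := Rmin_r d1 (1 - norm z0)); unfold r in *; lra).
exists ((1 - e) * r); split; [apply Rmult_lt_0_compat; lra |]; intros w Hw.
destruct (near_id_solve z0 w r Hr2 ltac:(lra)) as [z [Hz [Hz1 <-]]].
rewrite (Hg z Hz1), (Hg z0 Hz0).
assert (E : minus (minus z z0) (lin_fun m (minus (f z) (f z0))) =
   opp (lin_fun m (minus (minus (f z) (f z0)) (l (minus z z0))))).
{ rewrite (linear_minus m _ (l _) (lin_linear m)), Hm1; vring. }
rewrite E, norm_opp; apply Rle_trans with (1 := Hm2 _); fold k.
assert (h1 := H1 z ltac:(lra)).
assert (h2 := near_id_expanding z z0 Hz1 Hz0).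
assert (h3 : norm (minus z z0) <= k * norm (minus (f z) (f z0))).
{ apply Rmult_le_reg_l with (1 - e); [lra |]; unfold k.
  rewrite <- Rmult_assoc, Rinv_r by lra; lra. }
apply Rle_trans with (k * (d / (k * k) * (k * norm (minus (f z) (f z0))))).
- apply Rmult_le_compat_l; [lra |]; apply Rle_trans with (1 := h1).
  apply Rmult_le_compat_l; [| exact h3].
  apply Rlt_le, Rdiv_lt_0_compat; [exact Hd | now apply Rmult_lt_0_compat].
- right; field; lra.
Qed.

End NearIdentity.


Section Starlike.
Context {X : NM}.

Lemma open_along_line (P : X -> Prop) (y : X) (s : R) :
  open P -> P (scal (RtoC s : C_AbsRing) y) ->
  exists d, 0 < d /\ forall t, Rabs (t - s) < d -> P (scal (RtoC t : C_AbsRing) y).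
Proof.
intros HP Hs; assert (H := HP _ Hs); apply locally_iff in H; destruct H as [d [Hd H]].
assert (Hy := norm_ge_0 y).
exists (d / (norm y + 1)); split; [apply Rdiv_lt_0_compat; lra |]; intros t Ht; apply H.
assert (E : minus (scal (RtoC t : C_AbsRing) y) (scal (RtoC s : C_AbsRing) y)
   = scal (RtoC (t - s) : C_AbsRing) y) by vring.
apply Rle_lt_trans with (norm (scal (RtoC (t - s) : C_AbsRing) y));
  [right; exact (f_equal norm E) | rewrite norm_scal_R].
apply Rle_lt_trans with (Rabs (t - s) * (norm y + 1)).
- apply Rmult_le_compat_l; [apply Rabs_pos | lra].
- apply Rmult_lt_reg_r with (/ (norm y + 1)); [apply Rinv_0_lt_compat; lra |].
  rewrite Rmult_assoc, Rinv_r, Rmult_1_r by lra; exact Ht.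
Qed.

(** The supremum of the [t] for which [t y] lies in [P] belongs neither to [P] nor
    to [Q]. *)
Lemma starlike_not_split (D P Q : X -> Prop) (y : X) :
  open P -> open Q -> (forall x, D x -> P x \/ Q x) ->
  (forall x, ~ (D x /\ P x /\ Q x)) ->
  (forall t, 0 <= t <= 1 -> D (scal (RtoC t : C_AbsRing) y)) ->
  P zero -> Q y -> False.
Proof.
intros HP HQ Hcov Hdis HD H0 Hy.
assert (E0 : scal (RtoC 0 : C_AbsRing) y = zero) by vring.
assert (E1 : scal (RtoC 1 : C_AbsRing) y = y) by vring.
set (E := fun t => 0 <= t <= 1 /\ P (scal (RtoC t : C_AbsRing) y)).
destruct (completeness E) as [s [Hub Hlub]].
{ exists 1; intros t [Ht _]; lra. }
{ exists 0; split; [lra |]; rewrite E0; exact H0. }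
assert (Hs0 : 0 <= s) by (apply Hub; split; [lra | rewrite E0; exact H0]).
assert (Hs1 : s <= 1) by (apply Hlub; intros t [Ht _]; lra).
destruct (Hcov _ (HD s ltac:(lra))) as [Hs | Hs].
- destruct (Rle_lt_or_eq_dec s 1 Hs1) as [Hlt | ->].
  + destruct (open_along_line P y s HP Hs) as [d [Hd H]].
    set (t := Rmin 1 (s + d / 2)).
    assert (Hts : s < t) by (apply Rmin_glb_lt; lra).
    assert (Ht : t <= s + d / 2) by apply Rmin_r.
    assert (Ht1 : t <= 1) by apply Rmin_l.
    assert (Hb : t <= s); [| lra].
    apply Hub; split; [lra |]; apply H; rewrite Rabs_pos_eq; lra.
  + apply (Hdis y); rewrite <- E1 at 1; split; [apply HD; lra |].
    split; [rewrite <- E1; exact Hs | exact Hy].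
- destruct (open_along_line Q y s HQ Hs) as [d [Hd H]].
  assert (Hb : s <= s - d / 2); [| lra].
  apply Hlub; intros t [Ht HPt]; apply Rnot_lt_le; intros Hlt.
  assert (Hts : t <= s) by (apply Hub; split; assumption).
  apply (Hdis (scal (RtoC t : C_AbsRing) y)).
  split; [now apply HD | split; [exact HPt |]].
  apply H; apply Rabs_def1; lra.
Qed.

End Starlike.

(** * Starlike and convex images *)

Section HilbertGeometry.
Context {HS : HilbertSpace}.
Local Notation X := (CompleteNormedModule.NormedModule C_AbsRing (hilbert_carrier HS)).

Context (f : X -> X) (e : R).
Context (He : 0 <= e < 1).
Context (Hf : forall x y : X, norm x < 1 -> norm y < 1 ->
  norm (minus (minus (f x) x) (minus (f y) y)) <= e * norm (minus x y)).

Lemma abs_complete_Hilbert : abs_complete X.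
Proof. exact (@ex_series_le C_AbsRing HS). Qed.

(** Put [v = z - z'] and [F = f z]. As [(1 - t) F - v] is an increment of [f - id], the
    angle of [F] and [v] is at most [arcsin e]; as [t F - z' = f z' - z'], the angle of
    [F] and [z'] is at most [arcsin s]. Hence [v] makes no obtuse angle with [z']. *)
Lemma starlike_norm_le (s : R) (z z' : X) (t : R) :
  0 <= s -> e * e + s * s <= 1 ->
  (forall x : X, norm x < 1 -> norm (minus (f x) x) <= s * norm x) ->
  norm z < 1 -> norm z' < 1 -> 0 <= t <= 1 ->
  f z' = scal (RtoC t : C_AbsRing) (f z) -> norm z' <= norm z.
Proof.
intros Hs Hes Hfs Hz Hz' Ht E.
destruct (Req_dec t 0) as [-> | Ht0].
{ assert (E0 : f zero = zero).
  { apply eq_of_norm_minus; assert (h := Hfs zero).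
    rewrite norm_zero, Rmult_0_r in h; apply h; lra. }
  assert (E1 : z' = zero).
  { apply (near_id_injective f e He Hf); [exact Hz' | rewrite norm_zero; lra |].
    rewrite E, E0; vring. }
  rewrite E1, norm_zero; apply norm_ge_0. }
destruct (Req_dec t 1) as [-> | Ht1].
{ assert (E1 : z' = z).
  { apply (near_id_injective f e He Hf); [exact Hz' | exact Hz |].
    rewrite E; vring. }
  rewrite E1; apply Rle_refl. }
apply norm_le_of_obtuse.
apply (angle_sum (f z) (minus z z') z' (1 - t) t e s); try lra.
- assert (Ed : minus (scal (RtoC (1 - t) : C_AbsRing) (f z)) (minus z z') =
    minus (minus (f z) z) (minus (f z') z')) by (rewrite E; vring).
  rewrite Ed; now apply Hf.
- rewrite <- E; now apply Hfs.
Qed.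

(** Preimages of [t f(z)] are continued from [t = 1] downwards by steps of fixed length:
    by [starlike_norm_le] they stay in the ball of radius [norm z], so that the room left
    for the next step does not shrink. *)
Lemma starlike_image (s : R) (z : X) (t : R) :
  0 <= s -> e * e + s * s <= 1 ->
  (forall x : X, norm x < 1 -> norm (minus (f x) x) <= s * norm x) ->
  norm z < 1 -> 0 <= t <= 1 ->
  exists z' : X, norm z' < 1 /\ f z' = scal (RtoC t : C_AbsRing) (f z).
Proof.
intros Hs Hes Hfs Hz Ht.
(* The distance in the image that one step may cover. *)
set (eta := (1 - e) * ((1 - norm z) / 2)).
assert (Heta : 0 < eta) by (apply Rmult_lt_0_compat; lra).
assert (HN : exists N : nat, norm (f z) < INR N * eta).
{ destruct (INR_archimed eta (norm (f z)) Heta) as [N HN]; exists N; lra. }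
destruct HN as [N HN].
assert (HN0 : 0 < INR N).
{ apply Rnot_le_lt; intros h; assert (h0 := norm_ge_0 (f z)).
  assert (INR N * eta <= 0 * eta) by (apply Rmult_le_compat_r; lra); lra. }
set (c := (1 - t) / INR N).
assert (Hc : 0 <= c) by (apply Rmult_le_pos; [lra | apply Rlt_le, Rinv_0_lt_compat, HN0]).
assert (HcN : INR N * c = 1 - t) by (unfold c; field; lra).
assert (Hceta : c * norm (f z) <= eta).
{ apply Rmult_le_reg_l with (INR N); [exact HN0 |].
  rewrite <- Rmult_assoc, HcN.
  assert ((1 - t) * norm (f z) <= 1 * norm (f z))
    by (apply Rmult_le_compat_r; [apply norm_ge_0 | lra]); lra. }
assert (Hstep : forall n, (n <= N)%nat ->
  exists z' : X, norm z' < 1 /\ f z' = scal (RtoC (1 - INR n * c) : C_AbsRing) (f z)).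
{ induction n as [| n IH]; intros Hn.
  - exists z; split; [exact Hz |]; simpl; vring.
  - destruct IH as [z1 [Hz1 E1]]; [lia |].
    assert (Hn1 : INR n * c <= INR N * c)
      by (apply Rmult_le_compat_r; [exact Hc | apply le_INR; lia]).
    assert (Hn0 : 0 <= INR n * c) by (apply Rmult_le_pos; [apply pos_INR | exact Hc]).
    assert (Hle := starlike_norm_le s z z1 (1 - INR n * c) Hs Hes Hfs Hz Hz1 ltac:(lra) E1).
    destruct (near_id_solve abs_complete_Hilbert f e He Hf z1
      (scal (RtoC (1 - INR (S n) * c) : C_AbsRing) (f z)) ((1 - norm z) / 2))
      as [z2 [_ Hz2]]; [lra | | now exists z2].
    rewrite E1, S_INR.
    assert (E : minus (scal (RtoC (1 - (INR n + 1) * c) : C_AbsRing) (f z))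
        (scal (RtoC (1 - INR n * c) : C_AbsRing) (f z)) =
      opp (scal (RtoC c : C_AbsRing) (f z))) by vring.
    apply Rle_trans with (norm (opp (scal (RtoC c : C_AbsRing) (f z) : X)));
      [right; exact (f_equal norm E) |].
    rewrite norm_opp, norm_scal_pos by exact Hc; exact Hceta. }
destruct (Hstep N (Nat.le_refl N)) as [z' Hz']; exists z'.
replace t with (1 - INR N * c) by lra; exact Hz'.
Qed.

(** Let [q = t (1 - t) |x - y|^2]. Strict convexity of the ball leaves a ball of radius
    [q / 2] around [m = (1 - t) x + t y] inside the unit ball, while the right-hand side
    differs from [f m] by at most [b q / 2 <= (1 - e) q / 2]: the equation is solvable
    within that distance of [m]. *)
Lemma convex_image (b : R) (x y : X) (t : R) :
  0 <= b -> b + e <= 1 ->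
  (forall (x y : X) (t : R), norm x < 1 -> norm y < 1 -> 0 <= t <= 1 ->
    let m := plus (scal (RtoC (1 - t) : C_AbsRing) x) (scal (RtoC t : C_AbsRing) y) in
    norm (minus (plus (scal (RtoC (1 - t) : C_AbsRing) (minus (f x) x))
                      (scal (RtoC t : C_AbsRing) (minus (f y) y))) (minus (f m) m))
    <= b / 2 * (t * (1 - t) * (norm (minus x y) * norm (minus x y)))) ->
  norm x < 1 -> norm y < 1 -> 0 <= t <= 1 ->
  exists z : X, norm z < 1 /\
    f z = plus (scal (RtoC (1 - t) : C_AbsRing) (f x)) (scal (RtoC t : C_AbsRing) (f y)).
Proof.
intros Hb Hbe Hdef Hx Hy Ht.
assert (Hd := Hdef x y t Hx Hy Ht); simpl in Hd; clear Hdef.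
assert (Hn := norm_convex_comb t x y); simpl in Hn.
set (m := plus (scal (RtoC (1 - t) : C_AbsRing) x) (scal (RtoC t : C_AbsRing) y) : X) in *.
set (q := t * (1 - t) * (norm (minus x y) * norm (minus x y))) in *.
assert (Hq : 0 <= q).
{ apply Rmult_le_pos; [apply Rmult_le_pos; lra | apply Rle_0_sqr]. }
(* From [|m|^2 <= r^2 - q <= (r - q / 2)^2], the latter because [r <= 1]. *)
assert (Hm : norm m + q / 2 < 1).
{ set (r := Rmax (norm x) (norm y)).
  assert (Hr : r < 1) by (apply Rmax_lub_lt; assumption).
  assert (Hx0 := norm_ge_0 x); assert (Hy0 := norm_ge_0 y); assert (Hm0 := norm_ge_0 m).
  assert (Hxr : norm x <= r) by apply Rmax_l.
  assert (Hyr : norm y <= r) by apply Rmax_r.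
  assert (Hxx : norm x * norm x <= r * r) by (apply Rmult_le_compat; lra).
  assert (Hyy : norm y * norm y <= r * r) by (apply Rmult_le_compat; lra).
  assert (Hmm : norm m * norm m <= r * r - q).
  { rewrite Hn; assert ((1 - t) * (norm x * norm x) <= (1 - t) * (r * r))
      by (apply Rmult_le_compat_l; lra).
    assert (t * (norm y * norm y) <= t * (r * r)) by (apply Rmult_le_compat_l; lra). lra. }
  assert (Hqr : q <= r * r) by nra.
  apply Rle_lt_trans with r; [| exact Hr].
  apply Rnot_lt_le; intros h.
  assert (0 <= r - q / 2) by nra.
  assert ((r - q / 2) * (r - q / 2) < norm m * norm m) by nra.
  nra. }
destruct (near_id_solve abs_complete_Hilbert f e He Hf m
  (plus (scal (RtoC (1 - t) : C_AbsRing) (f x)) (scal (RtoC t : C_AbsRing) (f y))) (q / 2))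
  as [z [_ Hz]]; [exact Hm | | now exists z].
assert (E : minus (plus (scal (RtoC (1 - t) : C_AbsRing) (f x))
    (scal (RtoC t : C_AbsRing) (f y))) (f m) =
  minus (plus (scal (RtoC (1 - t) : C_AbsRing) (minus (f x) x))
              (scal (RtoC t : C_AbsRing) (minus (f y) y))) (minus (f m) m)).
{ generalize (f m); intros fm; unfold m; vring. }
apply Rle_trans with (b / 2 * q); [apply Rle_trans with (2 := Hd); right; exact (f_equal norm E) |].
replace (b / 2 * q) with (b * (q / 2)) by field.
apply Rmult_le_compat_r; lra.
Qed.

End HilbertGeometry.

(** * Numerical consequences of the coefficient conditions *)

(** Every branch satisfies [A alpha <= (2 - alpha) / sqrt 5], which is all that the
    inclusions require. *)
Lemma A_bound (alpha : R) : 0 <= alpha < 1 ->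
  0 <= A alpha /\ 5 * (A alpha * A alpha) <= (2 - alpha) * (2 - alpha).
Proof.
intros Ha; unfold A.
destruct (Rle_dec alpha (1 / 4)) as [H1 | H1].
- assert (Hp : 0 < sqrt (5 - 2 * alpha)) by (apply sqrt_lt_R0; lra).
  assert (Hq := sqrt_pos (1 - 2 * alpha)).
  assert (Sp := sqrt_sqrt (5 - 2 * alpha) ltac:(lra)).
  assert (Sq := sqrt_sqrt (1 - 2 * alpha) ltac:(lra)).
  set (p := sqrt (5 - 2 * alpha)) in *; set (q := sqrt (1 - 2 * alpha)) in *.
  split.
  + apply Rmult_le_pos; [apply Rmult_le_pos; lra | apply Rlt_le, Rinv_0_lt_compat, Hp].
  + replace (5 * ((2 - alpha) * q / p * ((2 - alpha) * q / p)))
      with ((2 - alpha) * (2 - alpha) * (5 * (q * q) / (p * p))) by (field; lra).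
    rewrite <- (Rmult_1_r ((2 - alpha) * (2 - alpha))) at 2.
    apply Rmult_le_compat_l; [nra |]; rewrite Sp, Sq.
    apply Rmult_le_reg_r with (5 - 2 * alpha); [lra |].
    unfold Rdiv; rewrite Rmult_assoc, Rinv_l by lra; lra.
- destruct (Rle_dec alpha (2 / 5)) as [H2 | H2].
  + assert (Hq : 0 <= (1 - alpha) / (2 + alpha) <= 1 / 3).
    { split; [apply Rmult_le_pos; [lra | apply Rlt_le, Rinv_0_lt_compat; lra] |].
      apply Rmult_le_reg_r with (2 + alpha); [lra |].
      unfold Rdiv; rewrite Rmult_assoc, Rinv_l by lra; lra. }
    replace ((2 - alpha) * (1 - alpha) / (2 + alpha))
      with ((2 - alpha) * ((1 - alpha) / (2 + alpha))) by (field; lra).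
    set (q := (1 - alpha) / (2 + alpha)) in *; split; [apply Rmult_le_pos; lra |].
    assert (q * q <= 1 / 3 * (1 / 3)) by (apply Rmult_le_compat; lra).
    replace (5 * ((2 - alpha) * q * ((2 - alpha) * q)))
      with ((2 - alpha) * (2 - alpha) * (5 * (q * q))) by ring.
    rewrite <- (Rmult_1_r ((2 - alpha) * (2 - alpha))) at 2.
    apply Rmult_le_compat_l; nra.
  + destruct (Rlt_dec alpha (1 / 2)) as [H3 | H3]; split; nra.
Qed.

Lemma is_series_ge0 (a : nat -> R) (s : R) : (forall n, 0 <= a n) -> is_series a s -> 0 <= s.
Proof.
intros Ha Hs; apply Rle_trans with (1 := Ha O).
apply (is_lim_seq_le (fun _ => a O) (sum_n a) (a O) s); [| apply is_lim_seq_const | exact Hs].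
intros n; induction n as [| n IH]; [rewrite sum_O; apply Rle_refl |].
rewrite sum_Sn; unfold plus; simpl; specialize (Ha (S n)); lra.
Qed.

Lemma is_series_le_le (a b : nat -> R) (s : R) :
  (forall n, 0 <= a n <= b n) -> is_series b s ->
  exists r, is_series a r /\ 0 <= r <= s.
Proof.
intros Hab Hb.
assert (Ha : ex_series a).
{ apply (ex_series_le (K := R_AbsRing) (V := R_CompleteNormedModule) a b); [| now exists s].
  intros n; change (Rabs (a n) <= b n); rewrite Rabs_pos_eq; apply Hab. }
exists (Series a); assert (H := Series_correct a Ha); split; [exact H |]; split.
- apply (is_series_ge0 a); [apply Hab | exact H].
- rewrite <- (is_series_unique b s Hb); apply Series_le; [exact Hab | now exists s].
Qed.

(** Since [k - alpha >= k (2 - alpha) / 2] for [k >= 2], the condition for [alpha] implies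
    the one for 0, namely that the sum of the [k a_k] is at most [2 / sqrt 5]. *)
Lemma weighted_coef_sum (alpha : R) (a : nat -> R) : 0 <= alpha < 1 -> (forall j, 0 <= a j) ->
  let u := fun j => (INR (j + 2) - alpha) * a j in
  ex_series u -> Series u <= A alpha ->
  exists e, is_series (fun j => INR (S (S j)) * a j) e /\ 0 <= e /\ 5 * (e * e) <= 4.
Proof.
intros Ha Ha0 u Hex Hle.
destruct (A_bound alpha Ha) as [HA0 HA].
assert (Hu := Series_correct u Hex).
destruct (is_series_le_le (fun j => INR (S (S j)) * a j) (fun j => 2 / (2 - alpha) * u j)
  (2 / (2 - alpha) * Series u)) as [e [He1 He2]].
- intros j; assert (h := pos_INR j); specialize (Ha0 j); unfold u.
  replace (j + 2)%nat with (S (S j)) by lia; rewrite !S_INR.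
  split; [apply Rmult_le_pos; lra |].
  rewrite <- Rmult_assoc; apply Rmult_le_compat_r; [exact Ha0 |].
  apply Rmult_le_reg_r with (2 - alpha); [lra |].
  replace (2 / (2 - alpha) * (INR j + 1 + 1 - alpha) * (2 - alpha))
    with (2 * (INR j + 1 + 1 - alpha)) by (field; lra).
  nra.
- exact (is_series_scal (V := R_NormedModule) _ _ _ Hu).
- exists e; split; [exact He1 |]; split; [lra |].
  assert (He : (2 - alpha) * e <= 2 * A alpha).
  { apply Rle_trans with ((2 - alpha) * (2 / (2 - alpha) * Series u)).
    - apply Rmult_le_compat_l; lra.
    - replace ((2 - alpha) * (2 / (2 - alpha) * Series u)) with (2 * Series u)
        by (field; lra); lra. }
  apply Rmult_le_reg_l with ((2 - alpha) * (2 - alpha)); [nra |].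
  assert (((2 - alpha) * e) * ((2 - alpha) * e) <= (2 * A alpha) * (2 * A alpha))
    by (apply Rmult_le_compat; try lra; apply Rmult_le_pos; lra).
  lra.
Qed.

Lemma coef_sum_half (a : nat -> R) (e : R) : (forall j, 0 <= a j) ->
  is_series (fun j => INR (S (S j)) * a j) e ->
  exists s, is_series a s /\ 0 <= s /\ 2 * s <= e.
Proof.
intros Ha He.
destruct (is_series_le_le (fun j => 2 * a j) (fun j => INR (S (S j)) * a j) e)
  as [s [Hs Hs2]]; [| exact He |].
- intros j; specialize (Ha j); rewrite !S_INR; assert (h := pos_INR j); nra.
- exists (/ 2 * s); split; [| lra].
  apply is_series_ext with (fun j => / 2 * (2 * a j)).
  + intros j; change (/ 2 * (2 * a j) = a j); field.
  + exact (is_series_scal (V := R_NormedModule) _ _ _ Hs).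
Qed.

(** * The terms of order at least two *)

Section HigherOrderPart.
Context {X : NM}.
Context (T : forall j, ML X X (S (S j))) (a : nat -> R) (h : X -> X).
Context (Ha : forall j, norm (T j) <= a j).
Context (Hh : forall z : X, norm z < 1 -> is_series (fun j => diag (T j) z) (h z)).

Lemma higher_order_lipschitz (e : R) (x y : X) :
  is_series (fun j => INR (S (S j)) * a j) e -> norm x < 1 -> norm y < 1 ->
  norm (minus (h x) (h y)) <= e * norm (minus x y).
Proof.
intros He Hx Hy.
apply (is_series_norm_le _ _ (fun j => INR (S (S j)) * a j * norm (minus x y)) _
  (is_series_minus _ _ _ _ (Hh x Hx) (Hh y Hy))).
- intros j; apply Rle_trans with
    (1 := diag_lipschitz (T j) x y 1 (Rlt_le _ _ Hx) (Rlt_le _ _ Hy)).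
  rewrite pow1, Rmult_1_r; apply Rmult_le_compat_r; [apply norm_ge_0 |].
  apply Rmult_le_compat_l; [apply pos_INR | apply Ha].
- exact (is_series_scal_r _ _ _ He).
Qed.

Lemma higher_order_quadratic (s : R) (x : X) : is_series a s -> norm x < 1 ->
  norm (h x) <= s * (norm x * norm x).
Proof.
intros Hs Hx; assert (H0 := norm_ge_0 x).
apply (is_series_norm_le _ _ (fun j => a j * (norm x * norm x)) _ (Hh x Hx)).
- intros j; apply Rle_trans with (1 := diag_norm (T j) x); simpl.
  assert (Hp : norm x ^ j <= 1) by (rewrite <- (pow1 j); apply pow_incr; lra).
  assert (Hp0 : 0 <= norm x ^ j) by now apply pow_le.
  apply Rmult_le_compat; [apply norm_ge_0 | repeat apply Rmult_le_pos; trivial | apply Ha |].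
  rewrite <- Rmult_assoc, <- (Rmult_1_r (norm x * norm x)) at 1.
  rewrite Rmult_1_r; rewrite <- (Rmult_1_r (norm x * norm x)) at 2.
  apply Rmult_le_compat_l; [nra | exact Hp].
- exact (is_series_scal_r _ _ _ Hs).
Qed.

Lemma higher_order_convexity_defect (b : R) (x y : X) (t : R) :
  is_series (fun j => INR (S (S j)) * (INR (S (S j)) - 1) * a j) b ->
  norm x < 1 -> norm y < 1 -> 0 <= t <= 1 ->
  let m := plus (scal (RtoC (1 - t) : C_AbsRing) x) (scal (RtoC t : C_AbsRing) y) in
  norm (minus (plus (scal (RtoC (1 - t) : C_AbsRing) (h x))
                    (scal (RtoC t : C_AbsRing) (h y))) (h m))
    <= b / 2 * (t * (1 - t) * (norm (minus x y) * norm (minus x y))).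
Proof.
intros Hb Hx Hy Ht m.
assert (Hm : norm m < 1).
{ unfold m; apply Rle_lt_trans with (1 := norm_triangle _ _).
  rewrite !norm_scal_pos by lra.
  destruct (Req_dec t 0) as [-> | Ht0]; [lra |].
  assert (t * norm y < t * 1) by (apply Rmult_lt_compat_l; lra).
  assert ((1 - t) * norm x <= (1 - t) * 1) by (apply Rmult_le_compat_l; lra). lra. }
set (q := t * (1 - t) * (norm (minus x y) * norm (minus x y))).
assert (Hq : 0 <= q).
{ apply Rmult_le_pos; [apply Rmult_le_pos; lra | apply Rle_0_sqr]. }
assert (S1 := is_series_minus _ _ _ _ (is_series_plus _ _ _ _
  (is_series_scal (RtoC (1 - t) : C_AbsRing) _ _ (Hh x Hx))
  (is_series_scal (RtoC t : C_AbsRing) _ _ (Hh y Hy))) (Hh m Hm)).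
apply (is_series_norm_le _ _
  (fun j => INR (S (S j)) * (INR (S (S j)) - 1) * a j * (q / 2)) _ S1).
- intros j; apply Rle_trans with
    (1 := diag_convexity_defect (T j) x y t (Rlt_le _ _ Hx) (Rlt_le _ _ Hy) Ht); fold q.
  apply Rle_trans with (INR (S (S j)) * (INR (S (S j)) - 1) * norm (T j) * (q / 2));
    [right; field |].
  apply Rmult_le_compat_r; [lra |]; apply Rmult_le_compat_l; [| apply Ha].
  rewrite !S_INR; assert (hj := pos_INR j); apply Rmult_le_pos; lra.
- replace (b / 2 * q) with (b * (q / 2)) by field; exact (is_series_scal_r _ _ _ Hb).
Qed.

End HigherOrderPart.

(** * Recovering a mapping from its Euler derivative *)

Section Radial.
Context {HS : HilbertSpace}.
Local Notation X := (CompleteNormedModule.NormedModule C_AbsRing (hilbert_carrier HS)).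

(** Along a radius, the real function [t |-> Re <d(t z), d z>] has derivative 0 for
    [t > 0] and is continuous at 0. The hypothesis says nothing on its derivative
    at 0 itself. *)
Lemma radially_constant (d : X -> X) :
  (forall z : X, norm z < 1 ->
     exists l : X -> X, filterdiff d (locally z) l /\ l z = zero) ->
  d zero = zero -> forall z : X, norm z < 1 -> d z = zero.
Proof.
intros Hd H0 z Hz.
set (u := d z).
set (psi := fun t => rdot (d (scal (RtoC t : C_AbsRing) z)) u).
assert (Hin : forall t, 0 <= t <= 1 -> norm (scal (RtoC t : C_AbsRing) z) < 1).
{ intros t Ht; rewrite norm_scal_pos by lra; assert (h := norm_ge_0 z).
  assert (t * norm z <= 1 * norm z) by (apply Rmult_le_compat_r; lra); lra. }
assert (Hz0 := norm_ge_0 z); assert (Hu0 := norm_ge_0 u).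
assert (Hdiff : forall s t, minus (scal (RtoC s : C_AbsRing) z) (scal (RtoC t : C_AbsRing) z)
   = scal (RtoC (s - t) : C_AbsRing) z) by (intros s t; vring).
assert (Hpsi : forall s t, Rabs (psi s - psi t) <=
   norm (minus (d (scal (RtoC s : C_AbsRing) z)) (d (scal (RtoC t : C_AbsRing) z))) * norm u).
{ intros s t; unfold psi; rewrite <- rdot_minus_l; apply rdot_bound. }
assert (Hcont : forall t, 0 <= t <= 1 -> continuity_pt psi t).
{ intros t Ht eps Heps.
  destruct (Hd _ (Hin t Ht)) as [l [Hl _]].
  assert (C := filterdiff_continuous d _ (ex_intro _ l Hl)).
  assert (HP : locally (d (scal (RtoC t : C_AbsRing) z))
    (fun y => norm (minus y (d (scal (RtoC t : C_AbsRing) z))) < eps / (norm u + 1))).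
  { apply locally_iff; exists (eps / (norm u + 1)); split; [apply Rdiv_lt_0_compat; lra |].
    trivial. }
  apply C, locally_iff in HP; destruct HP as [del [Hdel HP]].
  exists (del / (norm z + 1)); split; [apply Rdiv_lt_0_compat; lra |].
  intros s [_ Hs]; change (Rabs (s - t) < del / (norm z + 1)) in Hs.
  change (Rabs (psi s - psi t) < eps); apply Rle_lt_trans with (1 := Hpsi s t).
  assert (Hn : norm (minus (scal (RtoC s : C_AbsRing) z) (scal (RtoC t : C_AbsRing) z)) < del).
  { rewrite Hdiff, norm_scal_R.
    apply Rle_lt_trans with (Rabs (s - t) * (norm z + 1));
      [apply Rmult_le_compat_l; [apply Rabs_pos | lra] |].
    apply Rlt_le_trans with (del / (norm z + 1) * (norm z + 1));
      [apply Rmult_lt_compat_r; lra | right; field; lra]. }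
  specialize (HP _ Hn).
  apply Rle_lt_trans with
    (norm (minus (d (scal (RtoC s : C_AbsRing) z)) (d (scal (RtoC t : C_AbsRing) z)))
      * (norm u + 1)); [apply Rmult_le_compat_l; [apply norm_ge_0 | lra] |].
  apply Rlt_le_trans with (eps / (norm u + 1) * (norm u + 1));
    [apply Rmult_lt_compat_r; [lra | exact HP] | right; field; lra]. }
assert (Hder : forall t, 0 < t <= 1 -> is_derive psi t 0).
{ intros t Ht; apply is_derive_Reals; intros eps Heps.
  destruct (Hd _ (Hin t ltac:(lra))) as [l [Hl Hlz]].
  apply filterdiff_iff in Hl; destruct Hl as [Ll Hl].
  set (k := norm z * norm u + 1).
  assert (Hk : 0 < k) by (assert (h := Rmult_le_pos _ _ Hz0 Hu0); unfold k; lra).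
  destruct (Hl (eps / 2 / k)) as [del [Hdel Hs]]; [apply Rdiv_lt_0_compat; lra |].
  assert (Hdel' : 0 < del / (norm z + 1)) by (apply Rdiv_lt_0_compat; lra).
  exists (mkposreal _ Hdel'); intros h Hh0 Hh; simpl in Hh.
  set (y := scal (RtoC (t + h) : C_AbsRing) z : X).
  assert (Ey : minus y (scal (RtoC t : C_AbsRing) z) = scal (RtoC h : C_AbsRing) z)
    by (unfold y; rewrite Hdiff; replace (t + h - t) with h by ring; reflexivity).
  assert (Hlh : l (minus y (scal (RtoC t : C_AbsRing) z)) = zero).
  { replace (minus y (scal (RtoC t : C_AbsRing) z)) with
      (scal (RtoC (h / t) : C_AbsRing) (scal (RtoC t : C_AbsRing) z) : X).
    - rewrite (linear_scal l Ll), Hlz; exact (scal_zero_r _).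
    - rewrite Ey; vgoals; apply injective_projections; simpl; field; lra. }
  assert (Hny : norm (minus y (scal (RtoC t : C_AbsRing) z)) < del).
  { rewrite Ey, norm_scal_R.
    apply Rle_lt_trans with (Rabs h * (norm z + 1));
      [apply Rmult_le_compat_l; [apply Rabs_pos | lra] |].
    apply Rlt_le_trans with (del / (norm z + 1) * (norm z + 1));
      [apply Rmult_lt_compat_r; lra | right; field; lra]. }
  assert (Hs' := Hs y Hny); rewrite Hlh, Ey, norm_scal_R in Hs'.
  assert (Hs2 : norm (minus (d y) (d (scal (RtoC t : C_AbsRing) z)))
     <= eps / 2 / k * (Rabs h * norm z)).
  { apply Rle_trans with (2 := Hs'); right; f_equal; vring. }
  assert (Hh1 : 0 < Rabs h) by now apply Rabs_pos_lt.
  rewrite Rminus_0_r; unfold Rdiv at 1; rewrite Rabs_mult, Rabs_inv.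
  apply Rle_lt_trans with (eps / 2); [| lra].
  apply Rmult_le_reg_r with (Rabs h); [exact Hh1 |].
  rewrite Rmult_assoc, Rinv_l, Rmult_1_r by lra.
  apply Rle_trans with (1 := Hpsi _ _).
  apply Rle_trans with (eps / 2 / k * (Rabs h * norm z) * norm u);
    [apply Rmult_le_compat_r; [exact Hu0 | exact Hs2] |].
  apply Rle_trans with (eps / 2 / k * Rabs h * k);
    [| right; field; lra].
  rewrite <- Rmult_assoc, Rmult_assoc; apply Rmult_le_compat_l; [| unfold k; lra].
  apply Rmult_le_pos; [apply Rlt_le, Rdiv_lt_0_compat; lra | lra]. }
destruct (MVT_gen psi 0 1 (fun _ => 0)) as [c [_ Hc]].
{ rewrite Rmin_left, Rmax_right by lra; intros t Ht; apply Hder; lra. }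
{ rewrite Rmin_left, Rmax_right by lra; intros t Ht; apply Hcont; lra. }
assert (E1 : psi 1 = norm u * norm u).
{ unfold psi; rewrite <- rdot_norm; f_equal; unfold u; f_equal; vring. }
assert (E0 : psi 0 = 0).
{ unfold psi; replace (scal (RtoC 0 : C_AbsRing) z) with (zero : X) by vring.
  rewrite H0; replace (zero : X) with (scal (RtoC 0 : C_AbsRing) u : X) by vring.
  rewrite rdot_scal_l; ring. }
rewrite E1, E0 in Hc.
apply (@norm_eq_zero C_AbsRing X); fold u; nra.
Qed.

End Radial.

Lemma mlnorm_ge0 {X : NM} {k : nat} (T : Lk X k) : 0 <= mlnorm T.
Proof. rewrite mlnorm_norm; apply norm_ge_0. Qed.

Lemma mlnorm_scal {X : NM} {k : nat} (n : nat) (T : Lk X k) :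
  mlnorm (scal (RtoC (INR n) : C_AbsRing) T) = INR n * mlnorm T.
Proof. rewrite !mlnorm_norm; apply norm_scal_pos, pos_INR. Qed.

(** * The classes of mappings *)

Section Final.
Context {HS : HilbertSpace}.
Local Notation X := (CompleteNormedModule.NormedModule C_AbsRing (hilbert_carrier HS)).

Lemma abs_complete_Lk_Hilbert (k : nat) : abs_complete (Lk X k).
Proof. exact (abs_complete_Lk HS k). Qed.

Definition coef_norm (f : X -> X) (j : nat) : R := mlnorm (coef f (S (S j))).

Definition expansion_term (f : X -> X) (j : nat) : ML X X (S (S j)) :=
  lin_fun (ML_of_Lk X (S (S j))) (coef f (S (S j))).

Lemma expansion_term_norm (f : X -> X) (j : nat) : norm (expansion_term f j) <= coef_norm f j.
Proof. apply ML_of_Lk_le. Qed.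

Lemma coef_norm_ge0 (f : X -> X) (j : nat) : 0 <= coef_norm f j.
Proof. apply mlnorm_ge0. Qed.

Lemma has_expansion_iff (f : X -> X) :
  has_expansion (X := HS) f <-> forall z : X, norm z < 1 ->
    is_series (fun j => diag (expansion_term f j) z) (minus (f z) z).
Proof.
assert (E : forall (z : X) (j : nat), mapply (coef f (j + 2)) (fun _ => z) = diag (expansion_term f j) z).
{ intros z j; unfold expansion_term; rewrite diag_ML_of_Lk.
  replace (j + 2)%nat with (S (S j)) by lia; reflexivity. }
split; intros H z Hz.
- apply is_series_ext with (2 := H z Hz); intros j; exact (E z j).
- apply is_series_ext with (2 := H z Hz); intros j; symmetry; exact (E z j).
Qed.

Lemma ex_series_coef_norm (w : nat -> R) (f : X -> X) :
  (forall j, 1 <= w j) -> ex_series (fun j => w j * coef_norm f j) ->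
  ex_series (coef_norm f).
Proof.
intros Hw [s Hs]; destruct (is_series_le_le (coef_norm f) (fun j => w j * coef_norm f j) s) as [r [Hr _]];
  [| exact Hs | now exists r].
intros j; assert (h := coef_norm_ge0 f j); specialize (Hw j).
split; [exact h |]; rewrite <- (Rmult_1_l (coef_norm f j)) at 1.
now apply Rmult_le_compat_r.
Qed.


(** With [e] and [s] the sums of the [k a_k] and of the [a_k], the conditions
    [5 e^2 <= 4] and [2 s <= e] give [e^2 + s^2 <= 1]. *)
Lemma starlike_class (f : X -> X) (e s : R) :
  holomorphic_on (X := HS) B f -> has_expansion (X := HS) f ->
  is_series (fun j => INR (S (S j)) * coef_norm f j) e -> is_series (coef_norm f) s ->
  0 <= e -> 5 * (e * e) <= 4 -> 0 <= s -> 2 * s <= e ->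
  Sstar_class (X := HS) f.
Proof.
intros Hhol Hexp He Hs He0 He1 Hs0 Hs1.
assert (Hser := proj1 (has_expansion_iff f) Hexp).
assert (Hee : 0 <= e < 1) by nra.
assert (Hes : e * e + s * s <= 1) by nra.
assert (Hlip : forall x y : X, norm x < 1 -> norm y < 1 ->
  norm (minus (minus (f x) x) (minus (f y) y)) <= e * norm (minus x y)).
{ intros x y; exact (higher_order_lipschitz (expansion_term f) (coef_norm f) (fun z => minus (f z) z)
    (expansion_term_norm f) Hser e x y He). }
assert (Hquad : forall x : X, norm x < 1 ->
  norm (minus (f x) x) <= s * (norm x * norm x)).
{ intros x; exact (higher_order_quadratic (expansion_term f) (coef_norm f) (fun z => minus (f z) z)
    (expansion_term_norm f) Hser s x Hs). }
assert (Hsmall : forall x : X, norm x < 1 -> norm (minus (f x) x) <= s * norm x).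
{ intros x Hx; apply Rle_trans with (1 := Hquad x Hx).
  assert (h := norm_ge_0 x); apply Rmult_le_compat_l; [exact Hs0 | nra]. }
assert (HB0 : norm (zero : X) < 1) by (rewrite norm_zero; lra).
assert (Hf0 : f zero = zero).
{ apply eq_of_norm_minus; assert (h := Hsmall zero HB0); rewrite norm_zero in h; lra. }
assert (Hstar : forall (z : X) t, norm z < 1 -> 0 <= t <= 1 ->
  exists z' : X, norm z' < 1 /\ f z' = scal (RtoC t : C_AbsRing) (f z)).
{ intros z t; exact (starlike_image f e Hee Hlip s z t Hs0 Hes Hsmall). }
assert (Hopen : open (image (X := HS) f B)).
{ intros w Hw; exact (near_id_open abs_complete_Hilbert f e Hee Hlip w Hw). }
split; [| split].
- split; [exact Hhol |]; split.
  + split; [exists (f zero); exists zero; split; [exact HB0 | reflexivity] |].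
    split; [exact Hopen |].
    intros [P [Q [HP [HQ [Hcov [[p [Dp Pp]] [[q [Dq Qq]] Hdis]]]]]]].
    assert (Hseg : forall w : X, image (X := HS) f B w -> forall t, 0 <= t <= 1 ->
       image (X := HS) f B (scal (RtoC t : C_AbsRing) w)).
    { intros w [z [Hz <-]] t Ht; exact (Hstar z t Hz Ht). }
    assert (D0 : image (X := HS) f B (zero : X)) by (exists zero; split; [exact HB0 | exact Hf0]).
    destruct (Hcov _ D0) as [H0 | H0].
    * exact (starlike_not_split (image (X := HS) f B) P Q q HP HQ Hcov Hdis
        (Hseg q Dq) H0 Qq).
    * apply (starlike_not_split (image (X := HS) f B) Q P p HQ HP); trivial.
      -- intros x Dx; destruct (Hcov x Dx); [now right | now left].
      -- intros x [Dx [Qx Px]]; exact (Hdis x (conj Dx (conj Px Qx))).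
      -- exact (Hseg p Dp).
  + set (g := fun w : X => epsilon (inhabits (zero : X)) (fun z => norm z < 1 /\ f z = w)).
    assert (Hg : forall z : X, norm z < 1 -> g (f z) = z).
    { intros z Hz.
      assert (h := epsilon_spec (inhabits (zero : X)) (fun z' => norm z' < 1 /\ f z' = f z)
        (ex_intro _ z (conj Hz eq_refl))).
      exact (near_id_injective f e Hee Hlip _ z (proj1 h) Hz (proj2 h)). }
    exists g; split; [exact Hg |].
    intros w [z [Hz <-]].
    exact (near_id_inverse_diff abs_complete_Hilbert f e Hee Hlip g z Hz Hg (Hhol z Hz)).
- split; [exact Hf0 |].
  apply (filterdiff_iff f (fun x => x) (zero : X)); split; [exact is_linear_id |].
  intros d Hd; exists (Rmin 1 (d / (s + 1))).
  assert (Hds : 0 < d / (s + 1)) by (apply Rdiv_lt_0_compat; lra).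
  split; [apply Rmin_pos; lra |]; intros y Hy.
  assert (Ey : minus y zero = y) by vring.
  assert (Ef : minus (minus (f y) (f zero)) (minus y zero) = minus (f y) y)
    by (rewrite Hf0; vring).
  assert (Hy' : norm y < Rmin 1 (d / (s + 1))).
  { apply Rle_lt_trans with (2 := Hy); right; exact (f_equal norm (eq_sym Ey)). }
  assert (h1 := Rlt_le_trans _ _ _ Hy' (Rmin_l _ _)).
  assert (h2 := Rlt_le_trans _ _ _ Hy' (Rmin_r _ _)).
  apply Rle_trans with (norm (minus (f y) y)); [right; exact (f_equal norm Ef) |].
  apply Rle_trans with (d * norm y);
    [| right; exact (f_equal (fun v => d * norm v) (eq_sym Ey))].
  apply Rle_trans with (1 := Hquad y h1); assert (h := norm_ge_0 y).
  rewrite <- Rmult_assoc; apply Rmult_le_compat_r; [exact h |].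
  apply Rle_trans with ((s + 1) * (d / (s + 1))); [apply Rmult_le_compat; lra | right; field; lra].
- intros z t Hz Ht; exact (Hstar z t Hz Ht).
Qed.

Lemma SS_starlike (alpha : R) (f : X -> X) : 0 <= alpha < 1 ->
  SS (X := HS) alpha f -> Sstar_class (X := HS) f.
Proof.
intros Ha [Hhol [Hexp [Hex Hle]]].
assert (E : forall j, (INR (j + 2) - alpha) * mlnorm (coef f (j + 2)) =
   (INR (j + 2) - alpha) * coef_norm f j).
{ intros j; unfold coef_norm; replace (j + 2)%nat with (S (S j)) by lia; reflexivity. }
apply (ex_series_ext _ _ E) in Hex; apply (Rle_trans _ _ _ (Req_le _ _ (eq_sym (Series_ext _ _ E)))) in Hle.
destruct (weighted_coef_sum alpha (coef_norm f) Ha (coef_norm_ge0 f) Hex Hle) as [e [He [He0 He1]]].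
destruct (coef_sum_half (coef_norm f) e (coef_norm_ge0 f) He) as [s [Hs [Hs0 Hs1]]].
exact (starlike_class f e s Hhol Hexp He Hs He0 He1 Hs0 Hs1).
Qed.

(** With [k] the sum of the [n^2 a_n], the Lipschitz constant [e] and the bound [k - e] of
    the second derivative of [f - id] add up to [k < 1]. *)
Lemma SK_convex (alpha : R) (f : X -> X) : 0 <= alpha < 1 ->
  SK (X := HS) alpha f -> K_class (X := HS) f.
Proof.
intros Ha [Hhol [Hexp [Hex Hle]]].
set (a2 := fun j => INR (S (S j)) * coef_norm f j).
assert (Ha2 : forall j, 0 <= a2 j)
  by (intros j; apply Rmult_le_pos; [apply pos_INR | apply coef_norm_ge0]).
assert (E : forall j, INR (j + 2) * (INR (j + 2) - alpha) * mlnorm (coef f (j + 2)) =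
   (INR (j + 2) - alpha) * a2 j).
{ intros j; unfold a2, coef_norm; replace (j + 2)%nat with (S (S j)) by lia; ring. }
apply (ex_series_ext _ _ E) in Hex; apply (Rle_trans _ _ _ (Req_le _ _ (eq_sym (Series_ext _ _ E)))) in Hle.
destruct (weighted_coef_sum alpha a2 Ha Ha2 Hex Hle) as [k [Hk [Hk0 Hk1]]].
destruct (coef_sum_half a2 k Ha2 Hk) as [e [He [He0 He1]]].
destruct (coef_sum_half (coef_norm f) e (coef_norm_ge0 f) He) as [s [Hs [Hs0 Hs1]]].
destruct (starlike_class f e s Hhol Hexp He Hs He0 ltac:(nra) Hs0 Hs1)
  as [Hbi [Hnorm _]].
split; [exact Hbi |]; split; [exact Hnorm |].
assert (Hser := proj1 (has_expansion_iff f) Hexp).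
assert (Hee : 0 <= e < 1) by nra.
assert (Hlip : forall x y : X, norm x < 1 -> norm y < 1 ->
  norm (minus (minus (f x) x) (minus (f y) y)) <= e * norm (minus x y)).
{ intros x y; exact (higher_order_lipschitz (expansion_term f) (coef_norm f) (fun z => minus (f z) z)
    (expansion_term_norm f) Hser e x y He). }
assert (Hb : is_series (fun j => INR (S (S j)) * (INR (S (S j)) - 1) * coef_norm f j) (k - e)).
{ apply is_series_ext with (2 := is_series_minus _ _ _ _ Hk He).
  intros j; unfold a2, minus, plus, opp; simpl; ring. }
intros z1 z2 t Hz1 Hz2 Ht.
apply (convex_image f e Hee Hlip (k - e) z1 z2 t); try assumption; [lra | nra |].
intros x y u Hx Hy Hu; exact (higher_order_convexity_defect (expansion_term f) (coef_norm f)
  (fun z => minus (f z) z) (expansion_term_norm f) Hser (k - e) x y u Hb Hx Hy Hu).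
Qed.


(** Indexing by degree is what termwise differentiation and the weights [k] refer to. *)
Definition all_terms (T : forall j, ML X X (S (S j))) (n : nat) : ML X X n :=
  match n return ML X X n with
  | O => zero
  | S O => Lin_id X
  | S (S j) => T j
  end.

Definition all_norms (a : nat -> R) (n : nat) : R :=
  match n with O => 0 | S O => 1 | S (S j) => a j end.

Lemma all_terms_norm (T : forall j, ML X X (S (S j))) (a : nat -> R) :
  (forall j, norm (T j) <= a j) -> forall n, norm (all_terms T n) <= all_norms a n.
Proof.
intros Ha [| [| j]]; [exact (Req_le _ _ (@norm_zero _ X)) | apply Lin_id_norm | apply Ha].
Qed.

Lemma all_norms_radius (a : nat -> R) : ex_series a -> radius_ge1 (all_norms a).
Proof.
intros Ha; apply radius_ge1_of_ex_series.
now apply ex_series_incr_1, ex_series_incr_1.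
Qed.

Lemma is_series_drop2 (b : nat -> X) (l z : X) :
  b O = zero -> b 1%nat = z ->
  (is_series b l <-> is_series (fun j => b (S (S j))) (minus l z)).
Proof.
intros E0 E1; split; intros H.
- apply (is_series_incr_1 (fun j => b (S j))), (is_series_incr_1 b).
  assert (E : plus (plus (minus l z) (b 1%nat)) (b O) = l) by (rewrite E0, E1; vring).
  exact (eq_ind_r (is_series b) H E).
- apply is_series_decr_1, is_series_decr_1.
  assert (E : plus (plus l (opp (b O))) (opp (b 1%nat)) = minus l z)
    by (rewrite E0, E1; vring).
  exact (eq_ind_r (is_series (fun j => b (S (S j)))) H E).
Qed.

Lemma all_terms_series (T : forall j, ML X X (S (S j))) (l z : X) :
  is_series (fun n => diag (all_terms T n) z) l <->
  is_series (fun j => diag (T j) z) (minus l z).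
Proof. exact (is_series_drop2 (fun n => diag (all_terms T n) z) l z eq_refl eq_refl). Qed.

Lemma euler_terms_series (T : forall j, ML X X (S (S j))) (l z : X) :
  is_series (fun n => diag (scal (RtoC (INR n) : C_AbsRing) (all_terms T n)) z) l <->
  is_series (fun j => diag (scal (RtoC (INR (S (S j))) : C_AbsRing) (T j)) z) (minus l z).
Proof.
apply (is_series_drop2 (fun n => diag (scal (RtoC (INR n) : C_AbsRing) (all_terms T n)) z)).
- exact (scal_zero_r _).
- exact (scal_one z).
Qed.

Definition euler (f : X -> X) (z : X) : X := lin_fun (Df f z) z.

Section CommonTerms.
Context (T : forall j, ML X X (S (S j))) (a : nat -> R) (f : X -> X).
Context (Ha : forall j, norm (T j) <= a j).
Context (Hsum : ex_series a).
Context (Hf : forall z : X, norm z < 1 -> is_series (fun j => diag (T j) z) (minus (f z) z)).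

Let HT (z : X) (Hz : norm z < 1) : is_series (fun n => diag (all_terms T n) z) (f z) :=
  proj2 (all_terms_series T (f z) z) (Hf z Hz).

Lemma terms_differentiable (z : X) : norm z < 1 -> ex_filterdiff f (locally z).
Proof.
exact (expansion_differentiable abs_complete_Lk_Hilbert (all_terms T) (all_norms a) f
  (all_terms_norm T a Ha) (all_norms_radius a Hsum) HT z).
Qed.

Lemma euler_terms (z : X) : norm z < 1 ->
  is_series (fun j => diag (scal (RtoC (INR (S (S j))) : C_AbsRing) (T j)) z)
    (minus (euler f z) z).
Proof.
intros Hz; apply euler_terms_series.
exact (euler_series abs_complete_Lk_Hilbert (all_terms T) (all_norms a) f
  (all_terms_norm T a Ha) (all_norms_radius a Hsum) HT z Hz).
Qed.

Lemma euler_holomorphic (z : X) : norm z < 1 -> ex_filterdiff (euler f) (locally z).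
Proof.
exact (euler_differentiable abs_complete_Lk_Hilbert (all_terms T) (all_norms a) f
  (all_terms_norm T a Ha) (all_norms_radius a Hsum) HT z).
Qed.

Lemma coef_euler (k : nat) : coef (euler f) k = scal (RtoC (INR k) : C_AbsRing) (coef f k).
Proof.
exact (euler_coef abs_complete_Lk_Hilbert (all_terms T) (all_norms a) f
  (all_terms_norm T a Ha) (all_norms_radius a Hsum) HT k).
Qed.

End CommonTerms.

Lemma series_of_terms (T : forall j, ML X X (S (S j))) (a : nat -> R) :
  (forall j, norm (T j) <= a j) -> ex_series a ->
  exists F : X -> X, forall z : X, norm z < 1 ->
    is_series (fun j => diag (T j) z) (minus (F z) z).
Proof.
intros Ha Hsum.
assert (H : forall z : X, exists y, norm z < 1 -> is_series (fun j => diag (T j) z) (minus y z)).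
{ intros z; destruct (Rlt_dec (norm z) 1) as [Hz | Hz]; [| exists zero; lra].
  destruct (abs_complete_Hilbert (fun j => diag (T j) z) a) as [l Hl]; [| exact Hsum |].
  - intros j; apply Rle_trans with (a j * 1 ^ (S (S j))).
    + apply diag_le; [apply Ha | lra].
    + rewrite pow1; lra.
  - exists (plus l z); intros _.
    assert (E : minus (plus l z) z = l) by vring.
    exact (eq_ind_r (is_series (fun j => diag (T j) z)) Hl E). }
exists (fun z => epsilon (inhabits (zero : X))
  (fun y => norm z < 1 -> is_series (fun j => diag (T j) z) (minus y z))).
intros z Hz; exact (epsilon_spec (inhabits (zero : X))
  (fun y => norm z < 1 -> is_series (fun j => diag (T j) z) (minus y z)) (H z) Hz).
Qed.

Lemma expansion_zero (f : X -> X) : has_expansion (X := HS) f -> f zero = zero.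
Proof.
intros Hf; assert (HB0 : norm (zero : X) < 1) by (rewrite norm_zero; lra).
assert (H := proj1 (has_expansion_iff f) Hf zero HB0).
apply eq_of_norm_minus; apply Req_le.
rewrite (is_series_first _ _ H (fun j => diag_zero _)), diag_zero; exact norm_zero.
Qed.

(** The difference has zero radial derivative. *)
Lemma euler_determines (f F : X -> X) :
  (forall z : X, norm z < 1 -> ex_filterdiff f (locally z)) ->
  (forall z : X, norm z < 1 -> ex_filterdiff F (locally z)) ->
  f zero = F zero ->
  (forall z : X, norm z < 1 -> euler f z = euler F z) ->
  forall z : X, norm z < 1 -> f z = F z.
Proof.
intros Hf HF H0 HE z Hz; apply eq_of_norm_minus, Req_le.
assert (E : minus (f z) (F z) = zero); [| rewrite E; exact norm_zero].
apply (radially_constant (fun z => minus (f z) (F z))); [| | exact Hz].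
- intros x Hx; exists (fun v => minus (lin_fun (Df f x) v) (lin_fun (Df F x) v)); split.
  + exact (filterdiff_minus_fct f F _ _ (Df_correct f x (Hf x Hx)) (Df_correct F x (HF x Hx))).
  + assert (h := HE x Hx); unfold euler in h; rewrite h; vring.
- rewrite H0; vring.
Qed.

Lemma SK_SS_same_sum (alpha : R) (f g : X -> X) :
  (forall k, coef g k = scal (RtoC (INR k) : C_AbsRing) (coef f k)) ->
  forall j, INR (j + 2) * (INR (j + 2) - alpha) * mlnorm (coef f (j + 2)) =
    (INR (j + 2) - alpha) * mlnorm (coef g (j + 2)).
Proof. intros H j; rewrite H, mlnorm_scal; ring. Qed.

Lemma SK_to_SS (alpha : R) (f : X -> X) : 0 <= alpha < 1 ->
  SK (X := HS) alpha f -> SS (X := HS) alpha (euler f).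
Proof.
intros Ha [Hhol [Hexp [Hex Hle]]].
assert (Hsum : ex_series (coef_norm f)).
{ apply (ex_series_coef_norm (fun j => INR (j + 2) * (INR (j + 2) - alpha))).
  - intros j; rewrite plus_INR; simpl (INR 2); assert (h := pos_INR j); nra.
  - apply ex_series_ext with (2 := Hex); intros j; unfold coef_norm.
    replace (j + 2)%nat with (S (S j)) by lia; reflexivity. }
assert (Hser := proj1 (has_expansion_iff f) Hexp).
assert (Hc := coef_euler (expansion_term f) (coef_norm f) f (expansion_term_norm f) Hsum Hser).
split; [| split].
- intros z Hz; exact (euler_holomorphic _ _ _ (expansion_term_norm f) Hsum Hser z Hz).
- apply (proj2 (has_expansion_iff (euler f))); intros z Hz.
  apply is_series_ext with (2 := euler_terms _ _ _ (expansion_term_norm f) Hsum Hser z Hz).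
  intros j; f_equal; unfold expansion_term; rewrite Hc; symmetry.
  exact (linear_scal _ (lin_linear (ML_of_Lk X (S (S j)))) _ _).
- assert (E := SK_SS_same_sum alpha f (euler f) Hc).
  apply (ex_series_ext _ _ E) in Hex; apply (Rle_trans _ _ _ (Req_le _ _ (eq_sym (Series_ext _ _ E)))) in Hle.
  split; assumption.
Qed.

(** Nothing is known a priori on the growth of the coefficients of [f]. Dividing those of
    [euler f] by the degree gives a summable expansion of some [F] with the same Euler
    derivative as [f]; hence [f = F] on the ball, and [f] inherits the expansion. *)
Lemma SS_to_SK (alpha : R) (f : X -> X) : 0 <= alpha < 1 ->
  holomorphic_on (X := HS) B f -> has_expansion (X := HS) f ->
  SS (X := HS) alpha (euler f) -> SK (X := HS) alpha f.
Proof.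
intros Ha Hhol Hexp [Ghol [Gexp [Hex Hle]]].
assert (Hsum : ex_series (coef_norm (euler f))).
{ apply (ex_series_coef_norm (fun j => INR (j + 2) - alpha)).
  - intros j; rewrite plus_INR; simpl (INR 2); assert (h := pos_INR j); lra.
  - apply ex_series_ext with (2 := Hex); intros j; unfold coef_norm.
    replace (j + 2)%nat with (S (S j)) by lia; reflexivity. }
assert (Gser := proj1 (has_expansion_iff (euler f)) Gexp).
set (T := fun j => scal (RtoC (/ INR (S (S j))) : C_AbsRing) (expansion_term (euler f) j)
  : ML X X (S (S j))).
assert (Hk : forall j, 0 < INR (S (S j))) by (intros j; apply lt_0_INR; lia).
assert (HT : forall j, norm (T j) <= coef_norm (euler f) j).
{ intros j; unfold T; rewrite norm_scal_pos by (apply Rlt_le, Rinv_0_lt_compat, Hk).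
  assert (h := expansion_term_norm (euler f) j); assert (h0 := norm_ge_0 (expansion_term (euler f) j)).
  assert (/ INR (S (S j)) <= 1).
  { rewrite <- Rinv_1; apply Rinv_le_contravar; [lra |].
    rewrite S_INR; assert (h1 := pos_INR (S j)); lra. }
  assert (/ INR (S (S j)) * norm (expansion_term (euler f) j) <= 1 * norm (expansion_term (euler f) j))
    by (apply Rmult_le_compat_r; assumption).
  lra. }
destruct (series_of_terms T _ HT Hsum) as [F HF].
assert (HE : forall z : X, norm z < 1 -> euler f z = euler F z).
{ intros z Hz.
  assert (H1 := euler_terms T _ F HT Hsum HF z Hz).
  assert (H2 : is_series (fun j => diag (scal (RtoC (INR (S (S j))) : C_AbsRing) (T j)) z)
     (minus (euler f z) z)).
  { apply is_series_ext with (2 := Gser z Hz); intros j; unfold T.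
    rewrite !diag_scal; assert (hj := Hk j); revert hj; generalize (INR (S (S j))).
    intros c hc; vgoals; apply injective_projections; simpl; field; lra. }
  assert (H3 := is_series_unique_gen _ _ _ H2 H1).
  apply eq_of_norm_minus, Req_le.
  assert (E : minus (euler f z) (euler F z) =
    minus (minus (euler f z) z) (minus (euler F z) z)) by vring.
  rewrite E, H3; apply norm_minus_self. }
assert (F0 : F zero = zero).
{ assert (HB0 : norm (zero : X) < 1) by (rewrite norm_zero; lra).
  apply eq_of_norm_minus, Req_le.
  rewrite (is_series_first _ _ (HF zero HB0) (fun j => diag_zero _)), diag_zero.
  exact norm_zero. }
assert (HfF : forall z : X, norm z < 1 -> f z = F z).
{ apply euler_determines; [exact Hhol | | now rewrite F0, (expansion_zero f Hexp) | exact HE].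
  exact (terms_differentiable T _ F HT Hsum HF). }
assert (Hf : forall z : X, norm z < 1 -> is_series (fun j => diag (T j) z) (minus (f z) z)).
{ intros z Hz; rewrite (HfF z Hz); exact (HF z Hz). }
assert (Hc := coef_euler T _ f HT Hsum Hf).
split; [exact Hhol |]; split; [exact Hexp |].
assert (E := SK_SS_same_sum alpha f (euler f) Hc).
assert (E' := fun j => eq_sym (E j)).
apply (ex_series_ext _ _ E') in Hex; apply (Rle_trans _ _ _ (Req_le _ _ (eq_sym (Series_ext _ _ E')))) in Hle.
split; assumption.
Qed.

End Final.

Theorem theorem3 (X : HilbertSpace) (alpha : R) (Halpha : 0 <= alpha < 1) :
  (forall f : X -> X, SK alpha f -> K_class f) /\
  (forall f : X -> X, SS alpha f -> Sstar_class f) /\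
  (forall f : X -> X, holomorphic_on B f -> has_expansion f ->
     (SK alpha f <-> SS alpha (fun z => Df f z z))).
Proof.
split; [| split].
- intros f; exact (SK_convex alpha f Halpha).
- intros f; exact (SS_starlike alpha f Halpha).
- intros f Hhol Hexp; split.
  + exact (SK_to_SS alpha f Halpha).
  + exact (SS_to_SK alpha f Halpha Hhol Hexp).
Qed.
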